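(* Let $\phi$ be a smooth real-valued solution of the minimal surface equation $$(1+\phi_y^2)\phi_{xx}-2\phi_x\phi_y\phi_{xy}+(1+\phi_x^2)\phi_{yy}=0$$ on an open subset of $\mathbb{R}^2$. Put $u=\phi_{\bar z}$, $v=\phi_z=\bar u$ and $\zeta=\frac{\sqrt{1+4uv}-1}{2v}$, and let $p$ be a point at which $\phi_{zz}\phi_{\bar z\bar z}-\phi_{z\bar z}^2\neq 0$, so that near $p$ the function $\zeta$ is a complex coordinate on the graph of $\phi$. Let $F$ be a holomorphic function on a disc centred at $\zeta_0=\zeta(p)$ such that on this disc $$x=x_0+\Re\int_{\zeta_0}^{\zeta}(1-\omega^2)F'(\omega)\,d\omega,\quad y=y_0+\Re\int_{\zeta_0}^{\zeta}i(1+\omega^2)F'(\omega)\,d\omega,\quad \phi=\phi_0+\Re\int_{\zeta_0}^{\zeta}2\omega F'(\omega)\,d\omega,$$ where $(x_0,y_0,\phi_0)$ is the point of the graph over $p$, and suppose $F'(\zeta_0)\neq 0$. Then, near $p$, $\rho=F(\zeta)$ is a complex coordinate on the graph, with complex conjugate $\sigma=G(\bar\zeta)$, where $G(\eta)=\overline{F(\bar\eta)}$, and with $\rho_0=F(\zeta_0)$, $\sigma_0=\overline{\rho_0}$ there are real constants $c_1,c_2,c_3$ such that $$x=c_1+\frac{\rho+\sigma}{2}-\frac12\int_{\rho_0}^{\rho}(F^{-1}(\tilde\rho))^2\,d\tilde\rho-\frac12\int_{\sigma_0}^{\sigma}(G^{-1}(\tilde\sigma))^2\,d\tilde\sigma,$$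 $$y=c_2+\frac{\sigma-\rho}{2i}-\frac1{2i}\int_{\rho_0}^{\rho}(F^{-1}(\tilde\rho))^2\,d\tilde\rho+\frac1{2i}\int_{\sigma_0}^{\sigma}(G^{-1}(\tilde\sigma))^2\,d\tilde\sigma,$$ $$\phi=c_3+\int_{\rho_0}^{\rho}F^{-1}(\tilde\rho)\,d\tilde\rho+\int_{\sigma_0}^{\sigma}G^{-1}(\tilde\sigma)\,d\tilde\sigma.$$ Furthermore $\zeta=F^{-1}(\rho)=\dfrac{\partial\phi}{\partial\rho}$ and $\bar\zeta=G^{-1}(\sigma)=\dfrac{\partial\phi}{\partial\sigma}$, so that $$x=c_1+\frac{\rho+\sigma}{2}-\frac12\int_{\rho_0}^{\rho}(\phi_{\tilde\rho})^2\,d\tilde\rho-\frac12\int_{\sigma_0}^{\sigma}(\phi_{\tilde\sigma})^2\,d\tilde\sigma,$$ $$y=c_2+\frac{\sigma-\rho}{2i}-\frac1{2i}\int_{\rho_0}^{\rho}(\phi_{\tilde\rho})^2\,d\tilde\rho+\frac1{2i}\int_{\sigma_0}^{\sigma}(\phi_{\tilde\sigma})^2\,d\tilde\sigma,$$ and $\phi$ is the sum of a function of $\rho$ and a function of $\sigma$.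
   Context: Write $z=x+iy$, $\bar z=x-iy$. Subscripts $z,\bar z$ denote the Wirtinger derivatives $\partial_z=\frac12(\partial_x-i\partial_y)$, $\partial_{\bar z}=\frac12(\partial_x+i\partial_y)$. Similarly $\phi_\rho=\partial\phi/\partial\rho$ and $\phi_\sigma=\partial\phi/\partial\sigma$ are the Wirtinger derivatives with respect to $\rho$ and $\sigma=\bar\rho$ when $\phi$ is regarded as a function of $\rho$. The surface considered is the graph $\{(x,y,\phi(x,y))\}\subset\mathbb{R}^3$. Since $v=\bar u$, $uv=|u|^2\ge0$ and the square root is the nonnegative one. Where $u=v=0$, $\zeta$ is understood by continuity, $\zeta=2u/(1+\sqrt{1+4uv})=0$. $F^{-1}$ and $G^{-1}$ denote the local holomorphic inverses near $\rho_0$ and $\sigma_0$ with $F^{-1}(\rho_0)=\zeta_0$ and $G^{-1}(\sigma_0)=\overline{\zeta_0}$. All integrals are along paths in small discs around $\rho_0$, respectively $\sigma_0$. *)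

(* Defs.v *)
(* The Stdlib reals with Coquelicot. *)
From Stdlib Require Import Reals.
From Coquelicot Require Import Coquelicot.
Open Scope R_scope.

(* A point (x, y) of the plane is the complex number x + i y: Coquelicot's [C]
   is [R * R], with the product topology. *)

Definition Dx (f : C -> R) (z : C) : R := Derive (fun t => f (t, Im z)) (Re z).
Definition Dy (f : C -> R) (z : C) : R := Derive (fun t => f (Re z, t)) (Im z).

Fixpoint Ck (n : nat) (U : C -> Prop) (f : C -> R) : Prop :=
  match n with
  | O => forall z, U z -> continuous f z
  | S m =>
      (forall z, U z ->
         ex_derive (fun t => f (t, Im z)) (Re z) /\
         ex_derive (fun t => f (Re z, t)) (Im z)) /\
      Ck m U f /\ Ck m U (Dx f) /\ Ck m U (Dy f)
  end.

Definition smooth (U : C -> Prop) (f : C -> R) : Prop := forall n, Ck n U f.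

Definition Csmooth (U : C -> Prop) (f : C -> C) : Prop :=
  smooth U (fun z => Re (f z)) /\ smooth U (fun z => Im (f z)).

(* Wirtinger derivatives d/dz and d/dzbar. *)
Definition CDx (f : C -> C) (z : C) : C :=
  (Dx (fun w => Re (f w)) z, Dx (fun w => Im (f w)) z).
Definition CDy (f : C -> C) (z : C) : C :=
  (Dy (fun w => Re (f w)) z, Dy (fun w => Im (f w)) z).

Definition dz (f : C -> C) (z : C) : C := ((CDx f z - Ci * CDy f z) / 2)%C.
Definition dzbar (f : C -> C) (z : C) : C := ((CDx f z + Ci * CDy f z) / 2)%C.

Definition ofR (f : C -> R) : C -> C := fun z => RtoC (f z).

Definition minimal_surface_eq (U : C -> Prop) (phi : C -> R) : Prop :=
  forall z, U z ->
    (1 + Dy phi z ^ 2) * Dx (Dx phi) z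
    - 2 * Dx phi z * Dy phi z * Dy (Dx phi) z
    + (1 + Dx phi z ^ 2) * Dy (Dy phi) z = 0.

(* zeta = (sqrt (1 + 4uv) - 1) / (2v) with u = phi_zbar, v = phi_z, extended by
   0 where v = 0.  As v is the conjugate of u, 1 + 4uv is a real number >= 1;
   [Re] only serves to apply the real square root. *)
Definition zeta (phi : C -> R) (z : C) : C :=
  let u := dzbar (ofR phi) z in
  let v := dz (ofR phi) z in
  if Ceq_dec v 0 then RtoC 0
  else ((RtoC (sqrt (Re (1 + 4 * u * v))) - 1) / (2 * v))%C.

Definition Cdisc (a : C) (r : R) (w : C) : Prop := Cmod (w - a) < r.

Definition holomorphic_on (D : C -> Prop) (f : C -> C) : Prop :=
  forall w, D w -> ex_derive (K := C_AbsRing) (V := C_NormedModule) f w.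

Definition C1_path (D : C -> Prop) (a b : C) (g dg : R -> C) : Prop :=
  g 0 = a /\ g 1 = b /\
  forall t, 0 <= t <= 1 ->
    D (g t) /\
    is_derive (K := R_AbsRing) (V := C_R_NormedModule) g t (dg t) /\
    continuous dg t.

(* I is the integral of f from a to b along paths in D: every C^1 path gives
   this value.  In a disc, which contains the segment from a to b, there is at
   most one such I. *)
Definition is_CInt (D : C -> Prop) (f : C -> C) (a b I : C) : Prop :=
  forall g dg, C1_path D a b g dg ->
    is_RInt (V := C_R_NormedModule) (fun t => (f (g t) * dg t)%C) 0 1 I.

(* chi, a function on the part of the graph of phi lying over N, is a complex
   coordinate with values in V; psi is the inverse of chi.  The graph is
   identified with its projection to the plane.  Thus chi is a smooth
   diffeomorphism from N onto V, and it is compatible with the conformal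
   structure that the graph inherits from R^3: the parametrization
   X = (Re psi, Im psi, phi o psi) satisfies X_w . X_w = 0, that is,
   |X_s| = |X_t| and X_s . X_t = 0 for w = s + i t. *)
Definition complex_coordinate (phi : C -> R) (N : C -> Prop) (chi : C -> C)
    (V : C -> Prop) (psi : C -> C) : Prop :=
  open N /\ open V /\
  (forall z, N z -> V (chi z) /\ psi (chi z) = z) /\
  (forall w, V w -> N (psi w) /\ chi (psi w) = w) /\
  Csmooth N chi /\ Csmooth V psi /\
  (forall w, V w ->
     (dz (ofR (fun s => Re (psi s))) w ^ 2
      + dz (ofR (fun s => Im (psi s))) w ^ 2
      + dz (ofR (fun s => phi (psi s))) w ^ 2)%C = RtoC 0).

(* g, on the disc of radius r' centred at f a, is the holomorphic local inverse
   with g (f a) = a of a function f defined on the disc of radius r centred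
   at a. *)
Definition local_inverse (f : C -> C) (a : C) (r : R) (g : C -> C) (r' : R)
  : Prop :=
  holomorphic_on (Cdisc (f a) r') g /\
  g (f a) = a /\
  (forall w, Cdisc (f a) r' w -> Cdisc a r (g w) /\ f (g w) = w) /\
  locally a (fun w => g (f w) = w).

(* With zeta0 = zeta p, the equations
     x   = x0   + Re int_zeta0^zeta (1 - w^2) F'(w) dw,
     y   = y0   + Re int_zeta0^zeta i (1 + w^2) F'(w) dw,
     phi = phi0 + Re int_zeta0^zeta 2 w F'(w) dw
   at the point of the graph over z, (x0, y0, phi0) being the one over p. *)
Definition weierstrass_at (phi : C -> R) (p : C) (r : R) (F : C -> C) (z : C)
  : Prop :=
  let D := Cdisc (zeta phi p) r in
  exists I1 I2 I3 : C,
    is_CInt D (fun w => (1 - w ^ 2) * C_derive F w)%C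
      (zeta phi p) (zeta phi z) I1 /\
    is_CInt D (fun w => Ci * (1 + w ^ 2) * C_derive F w)%C
      (zeta phi p) (zeta phi z) I2 /\
    is_CInt D (fun w => 2 * w * C_derive F w)%C
      (zeta phi p) (zeta phi z) I3 /\
    Re z = Re p + Re I1 /\
    Im z = Im p + Re I2 /\
    phi z = phi p + Re I3.

(* Main.v *)
Require Import Defs.
From Stdlib Require Import Reals Lra Lia ClassicalEpsilon.
From Coquelicot Require Import Coquelicot.
Open Scope R_scope.

(** Put [u = phi_zbar] and [v = phi_z]. Then [zeta] lies in the unit disc and
    [u = zeta / (1 - |zeta|^2)]. Differentiating this relation and inserting it into the
    minimal surface equation gives [zeta_z = Cconj zeta ^ 2 zeta_zbar]
    ([zeta_derivatives]); the same computation shows that the Jacobian of [zeta] is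
    nonzero where the Hessian determinant of [phi] is. For every chart [chi] with
    [chi_z = Cconj zeta ^ 2 chi_zbar] the inverse [psi] satisfies
    [psi_w = - zeta^2 Cconj psi_wbar], from which both the conformality of the chart and
    [phi_w = zeta Cconj psi_wbar] follow ([conformal_parametrization],
    [surface_coordinate]). The relation holds for [zeta], and it is inherited by
    [rho = F o zeta] because [F] is holomorphic.

    The Weierstrass formulas determine [F]: for the inverse [psi] of [zeta] they give
    [F' = Cconj psi_zetabar] ([weierstrass_density]). In the coordinate [rho] this means
    [psi_rhobar = 1]. Hence [phi_rho = zeta] and
    [x + i y = sigma - int zeta^2 drho + const], an identity whose real and imaginary
    parts are the formulas for [x] and [y]. Finally [phi] differs by a constant from twice
    the real part of a primitive of [zeta = F^-1 (rho)], since both have the same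
    derivatives.

    The smoothness of [F], which makes [rho] smooth, is read off
    [F' = Cconj psi_zetabar]; the proof of this identity differentiates the
    Weierstrass integrals without knowing that [F'] is continuous
    ([path_integral_derivative]). Smooth changes of coordinates are handled by a calculus
    of Wirtinger derivatives ([rdiff], [CkC]) and an inverse function theorem proved by
    contraction ([inverse_function]). *)

(** * Real differentiability in Wirtinger form *)

(** [C] carries two uniform structures, the product one and the one of its modulus.
    [near] fixes the first, with which [open] is read; [near_Cmod] gives access
    to the second. *)
Definition near (z : C) (P : C -> Prop) : Prop := @locally C_UniformSpace z P.

Lemma near_Cmod (z : C) (P : C -> Prop) :
  near z P <-> exists d, 0 < d /\ forall w, Cmod (w - z) < d -> P w.
Proof.
  split.
  - intros [d Hd]. exists d. split. apply cond_pos.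
    intros w Hw. apply Hd. apply C_NormedModule_mixin_compat1. exact Hw.
  - intros [d [Hd H]].
    assert (Hs : 0 < sqrt 2) by (apply sqrt_lt_R0; lra).
    exists (mkposreal (d / sqrt 2) (Rdiv_lt_0_compat _ _ Hd Hs)).
    intros w Hw. apply H. apply C_NormedModule_mixin_compat2 in Hw.
    simpl in Hw. replace (sqrt 2 * (d / sqrt 2)) with d in Hw. exact Hw.
    field. lra.
Qed.

Lemma near_disc (z : C) (d : R) : 0 < d -> near z (Cdisc z d).
Proof. intros Hd. apply near_Cmod. exists d. split; auto. Qed.

Lemma near_self (z : C) (P : C -> Prop) : near z P -> P z.
Proof. apply (locally_singleton (T := C_UniformSpace)). Qed.

Lemma near_and z P Q : near z P -> near z Q -> near z (fun w => P w /\ Q w).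
Proof. apply filter_and. Qed.

Lemma near_imp z (P Q : C -> Prop) : (forall w, P w -> Q w) -> near z P -> near z Q.
Proof. apply filter_imp. Qed.

(** Real differentiability at [z], with [a] and [b] as derivatives with respect to
    [z] and [Cconj z]. Every real-linear map of the plane is [h |-> a h + b Cconj h],
    and [b = 0] expresses complex differentiability. *)
Definition rdiff (f : C -> C) (z a b : C) : Prop :=
  forall eps, 0 < eps -> near z (fun w =>
    Cmod (f w - f z - (a * (w - z) + b * Cconj (w - z))) <= eps * Cmod (w - z)).

Definition ccont (f : C -> C) (z : C) : Prop :=
  forall eps, 0 < eps -> near z (fun w => Cmod (f w - f z) < eps).

Lemma Cmod_minus_sym (a b : C) : Cmod (a - b) = Cmod (b - a).
Proof. rewrite <- Cmod_opp. f_equal. ring. Qed.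

Lemma ccont_near f z P : ccont f z -> near (f z) P -> near z (fun w => P (f w)).
Proof.
  intros Hf HP. apply near_Cmod in HP. destruct HP as [d [Hd HP]].
  generalize (Hf d Hd). apply near_imp. intros w. apply HP.
Qed.

Lemma rdiff_ext f g z a b :
  near z (fun w => f w = g w) -> rdiff f z a b -> rdiff g z a b.
Proof.
  intros E H eps He. rewrite <- (near_self _ _ E).
  generalize (near_and _ _ _ E (H eps He)). apply near_imp.
  intros w [-> Hw]. exact Hw.
Qed.

Lemma ccont_ext f g z : near z (fun w => f w = g w) -> ccont f z -> ccont g z.
Proof.
  intros E H eps He. rewrite <- (near_self _ _ E).
  generalize (near_and _ _ _ E (H eps He)). apply near_imp.
  intros w [-> Hw]. exact Hw.
Qed.

Lemma rdiff_lip f z a b : rdiff f z a b ->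
  near z (fun w => Cmod (f w - f z) <= (Cmod a + Cmod b + 1) * Cmod (w - z)).
Proof.
  intros H. generalize (H 1 Rlt_0_1). apply near_imp. intros w Hw.
  replace (f w - f z)%C with
    ((f w - f z - (a * (w - z) + b * Cconj (w - z))) + (a * (w-z) + b * Cconj (w-z)))%C by ring.
  eapply Rle_trans. apply Cmod_triangle.
  eapply Rle_trans. apply Rplus_le_compat. exact Hw. apply Cmod_triangle.
  rewrite !Cmod_mult, Cmod_conj. lra.
Qed.

Lemma rdiff_ccont f z a b : rdiff f z a b -> ccont f z.
Proof.
  intros H eps He. generalize (rdiff_lip _ _ _ _ H). intros L.
  set (M := Cmod a + Cmod b + 1) in *.
  assert (HM : 0 < M) by (generalize (Cmod_ge_0 a), (Cmod_ge_0 b); unfold M; lra).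
  generalize (near_and _ _ _ L (near_disc z (eps / M) (Rdiv_lt_0_compat _ _ He HM))).
  apply near_imp. unfold Cdisc. intros w [H1 H2].
  eapply Rle_lt_trans. exact H1.
  apply Rmult_lt_compat_l with (r := M) in H2; auto.
  replace (M * (eps / M)) with eps in H2 by (field; lra). exact H2.
Qed.

Lemma rdiff_const c z : rdiff (fun _ => c) z 0 0.
Proof.
  intros eps He. apply near_Cmod. exists 1. split. lra. intros w _.
  replace (c - c - (0 * (w - z) + 0 * Cconj (w - z)))%C with (RtoC 0) by ring.
  rewrite Cmod_0. apply Rmult_le_pos. lra. apply Cmod_ge_0.
Qed.

Lemma rdiff_id z : rdiff (fun w => w) z 1 0.
Proof.
  intros eps He. apply near_Cmod. exists 1. split. lra. intros w _.
  replace (w - z - (1 * (w - z) + 0 * Cconj (w - z)))%C with (RtoC 0) by ring.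
  rewrite Cmod_0. apply Rmult_le_pos. lra. apply Cmod_ge_0.
Qed.

Lemma rdiff_Cconj z : rdiff Cconj z 0 1.
Proof.
  intros eps He. apply near_Cmod. exists 1. split. lra. intros w _.
  rewrite Cminus_conj.
  replace (Cconj w - Cconj z - (0 * (w - z) + 1 * (Cconj w - Cconj z)))%C with (RtoC 0) by ring.
  rewrite Cmod_0. apply Rmult_le_pos. lra. apply Cmod_ge_0.
Qed.

Lemma rdiff_plus f g z a b c d :
  rdiff f z a b -> rdiff g z c d -> rdiff (fun w => f w + g w)%C z (a + c) (b + d).
Proof.
  intros Hf Hg eps He. assert (He2 : 0 < eps / 2) by lra.
  generalize (near_and _ _ _ (Hf _ He2) (Hg _ He2)). apply near_imp.
  intros w [H1 H2].
  replace (f w + g w - (f z + g z) - ((a + c) * (w - z) + (b + d) * Cconj (w - z)))%C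
    with ((f w - f z - (a * (w - z) + b * Cconj (w - z)))
        + (g w - g z - (c * (w - z) + d * Cconj (w - z))))%C by ring.
  eapply Rle_trans. apply Cmod_triangle. lra.
Qed.

(** With [k = f w - f z], the linear part of [g] at [k] differs from its value at the
    linear part of [k] by [o(w - z)], and the remainder of [g] is [o(k)] where
    [k = O(w - z)] by [rdiff_lip]. *)
Lemma rdiff_comp f g z a b c d :
  rdiff f z a b -> rdiff g (f z) c d ->
  rdiff (fun w => g (f w)) z (c * a + d * Cconj b) (c * b + d * Cconj a).
Proof.
  intros Hf Hg eps He.
  set (M := Cmod a + Cmod b + 1). set (K := Cmod c + Cmod d + 1).
  assert (HM : 0 < M) by (generalize (Cmod_ge_0 a), (Cmod_ge_0 b); unfold M; lra).
  assert (HK : 0 < K) by (generalize (Cmod_ge_0 c), (Cmod_ge_0 d); unfold K; lra).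
  assert (He1 : 0 < eps / 2 / K) by (apply Rdiv_lt_0_compat; lra).
  assert (He2 : 0 < eps / 2 / M) by (apply Rdiv_lt_0_compat; lra).
  generalize (near_and _ _ _ (near_and _ _ _ (Hf _ He1) (rdiff_lip _ _ _ _ Hf))
    (ccont_near _ _ _ (rdiff_ccont _ _ _ _ Hf) (Hg _ He2))).
  fold M. apply near_imp. intros w [[H1 H2] H3].
  set (h := (w - z)%C) in *. set (k := (f w - f z)%C) in *.
  set (e := (k - (a * h + b * Cconj h))%C) in *.
  set (r := (g (f w) - g (f z) - (c * k + d * Cconj k))%C) in *.
  replace (g (f w) - g (f z) -
    ((c * a + d * Cconj b) * h + (c * b + d * Cconj a) * Cconj h))%C
    with (r + (c * e + d * Cconj e))%C.
  2:{ unfold r, e. rewrite Cminus_conj, Cplus_conj, !Cmult_conj, Cconj_conj. ring. }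
  eapply Rle_trans. apply Cmod_triangle.
  assert (Ha : Cmod (c * e + d * Cconj e) <= K * Cmod e).
  { eapply Rle_trans. apply Cmod_triangle. rewrite !Cmod_mult, Cmod_conj.
    unfold K. generalize (Cmod_ge_0 e). lra. }
  assert (Hb : K * Cmod e <= eps / 2 * Cmod h).
  { replace (eps / 2 * Cmod h) with (K * (eps / 2 / K * Cmod h)) by (field; lra).
    apply Rmult_le_compat_l; lra. }
  assert (Hc : eps / 2 / M * Cmod k <= eps / 2 * Cmod h).
  { replace (eps / 2 * Cmod h) with (eps / 2 / M * (M * Cmod h)) by (field; lra).
    apply Rmult_le_compat_l; lra. }
  lra.
Qed.

Lemma rdiff_sqr z : rdiff (fun w => w * w)%C z (2 * z) 0.
Proof.
  intros eps He. generalize (near_disc z eps He). apply near_imp. unfold Cdisc. intros w Hw.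
  replace (w * w - z * z - (2 * z * (w - z) + 0 * Cconj (w - z)))%C
    with ((w - z) * (w - z))%C by ring.
  rewrite Cmod_mult. apply Rmult_le_compat_r. apply Cmod_ge_0. lra.
Qed.

Lemma rdiff_eq f z a b a' b' : rdiff f z a b -> a = a' -> b = b' -> rdiff f z a' b'.
Proof. intros H -> ->. exact H. Qed.

Lemma Cconj_RtoC (x : R) : Cconj (RtoC x) = RtoC x.
Proof. unfold Cconj, RtoC; simpl. f_equal. ring. Qed.

Lemma rdiff_scal k f z a b : rdiff f z a b -> rdiff (fun w => k * f w)%C z (k * a) (k * b).
Proof.
  intros H.
  assert (L : rdiff (fun w => k * w)%C (f z) k 0).
  { intros eps He. apply near_Cmod. exists 1. split. lra. intros w _.
    replace (k * w - k * f z - (k * (w - f z) + 0 * Cconj (w - f z)))%C with (RtoC 0) by ring.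
    rewrite Cmod_0. apply Rmult_le_pos. lra. apply Cmod_ge_0. }
  eapply rdiff_eq. exact (rdiff_comp _ _ _ _ _ _ _ H L). ring. ring.
Qed.

(** By polarization: [4 f g = (f + g)^2 - (f - g)^2], so the chain rule for
    squaring suffices. *)
Lemma rdiff_mult f g z a b c d :
  rdiff f z a b -> rdiff g z c d ->
  rdiff (fun w => f w * g w)%C z (a * g z + f z * c) (b * g z + f z * d).
Proof.
  intros Hf Hg.
  assert (Hm := rdiff_plus _ _ _ _ _ _ _ Hf (rdiff_scal (-1) _ _ _ _ Hg)).
  assert (Hp := rdiff_plus _ _ _ _ _ _ _ Hf Hg).
  assert (H1 := rdiff_comp _ _ _ _ _ _ _ Hp (rdiff_sqr _)).
  assert (H2 := rdiff_comp _ _ _ _ _ _ _ Hm (rdiff_sqr _)).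
  assert (H3 := rdiff_scal (/4) _ _ _ _ (rdiff_plus _ _ _ _ _ _ _ H1 (rdiff_scal (-1) _ _ _ _ H2))).
  cbv beta in H3.
  eapply rdiff_eq. eapply rdiff_ext. 2: exact H3.
  - apply filter_forall. intros w. field.
  - field.
  - field.
Qed.

Lemma rdiff_conj f z a b : rdiff f z a b -> rdiff (fun w => Cconj (f w)) z (Cconj b) (Cconj a).
Proof.
  intros H. eapply rdiff_eq. exact (rdiff_comp _ _ _ _ _ _ _ H (rdiff_Cconj _)). ring. ring.
Qed.

Lemma rdiff_Cinv (z : C) : z <> 0 -> rdiff Cinv z (- (/ z * / z)) 0.
Proof.
  intros Hz eps He.
  assert (Hz' : 0 < Cmod z) by (apply Cmod_gt_0; exact Hz).
  set (m := Cmod z) in *.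
  assert (Hd : 0 < Rmin (m / 2) (eps * (m * m * m) / 2)).
  { apply Rmin_pos. lra. apply Rdiv_lt_0_compat; [|lra]. repeat apply Rmult_lt_0_compat; lra. }
  generalize (near_disc z _ Hd). apply near_imp. unfold Cdisc. intros w Hw.
  assert (H1 := Rlt_le_trans _ _ _ Hw (Rmin_l _ _)).
  assert (H2 := Rlt_le_trans _ _ _ Hw (Rmin_r _ _)).
  assert (Hwm : m / 2 < Cmod w).
  { assert (m <= Cmod w + Cmod (w - z)).
    { unfold m. replace z with (w + - (w - z))%C at 1 by ring.
      rewrite <- (Cmod_opp (w - z)). apply Cmod_triangle. }
    lra. }
  assert (Hw0 : w <> 0) by (apply Cmod_gt_0; lra).
  replace (/ w - / z - (- (/ z * / z) * (w - z) + 0 * Cconj (w - z)))%C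
    with ((w - z) * (w - z) / (z * z * w))%C by (field; auto).
  rewrite Cmod_div. 2:{ repeat apply Cmult_neq_0; auto. }
  rewrite !Cmod_mult. fold m. set (x := Cmod (w - z)) in *.
  assert (Hx : 0 <= x) by apply Cmod_ge_0.
  assert (Hmm : 0 < m * m) by nra.
  assert (Hq : m * m * (m / 2) <= m * m * Cmod w) by nra.
  apply Rle_div_l. nra.
  apply Rle_trans with (eps * x * (m * m * (m / 2))).
  - replace (eps * x * (m * m * (m / 2))) with (x * (eps * (m * m * m) / 2)) by field.
    apply Rmult_le_compat_l; lra.
  - apply Rmult_le_compat_l; nra.
Qed.

(** The derivative is shared equally between the two Wirtinger derivatives because
    [Re h = (h + Cconj h) / 2]. *)
Lemma rdiff_real (k : R -> R) (z : C) (l : R) :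
  is_derive k (Re z) l -> rdiff (fun w => RtoC (k (Re w))) z (l / 2)%C (l / 2)%C.
Proof.
  intros [_ H] eps He.
  specialize (H (Re z) (fun P HP => HP)).
  destruct (H (mkposreal eps He)) as [d Hd].
  apply near_Cmod. exists d. split. apply cond_pos. intros w Hw.
  assert (Hr : Rabs (Re w - Re z) <= Cmod (w - z)).
  { replace (Re w - Re z) with (Re (w - z)%C) by (unfold Re; simpl; ring). apply re_le_Cmod. }
  assert (Hb : ball (Re z) d (Re w)).
  { apply Rle_lt_trans with (2 := Hw). exact Hr. }
  specialize (Hd _ Hb). simpl in Hd.
  unfold norm, minus, plus, opp, scal, mult in Hd; simpl in Hd.
  unfold abs in Hd; simpl in Hd.
  replace (k (Re w) - k (Re z) - (l / 2 * (w - z) + l / 2 * Cconj (w - z)))%C with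
    (RtoC (k (Re w) + - k (Re z) + - ((Re w + - Re z) * l))).
  - rewrite Cmod_R. unfold mult in Hd; simpl in Hd. eapply Rle_trans. exact Hd.
    apply Rmult_le_compat_l. lra. exact Hr.
  - apply injective_projections; unfold Re, Im; simpl; field.
Qed.

Lemma norm_increment (x y v : C) (r : R) :
  norm (minus (minus (x : C_R_NormedModule) y) (scal r (v : C_R_NormedModule)))
  = Cmod (x - y - RtoC r * v).
Proof.
  unfold norm, minus, plus, opp, scal; simpl. unfold prod_norm, Cmod.
  f_equal. unfold norm, scal, mult, plus, opp; simpl. unfold abs, mult, plus, opp; simpl.
  rewrite !Rmult_1_r, <- !Rabs_mult. rewrite (Rabs_pos_eq (_ * _)) by apply Rle_0_sqr. rewrite (Rabs_pos_eq (_ * _)) by apply Rle_0_sqr.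
  unfold scal; simpl; unfold mult; simpl. ring.
Qed.

Lemma rdiff_along f g t a b (d : C) :
  is_derive (K := R_AbsRing) (V := C_R_NormedModule) g t d -> rdiff f (g t) a b ->
  is_derive (K := R_AbsRing) (V := C_R_NormedModule) (fun s => f (g s)) t (a * d + b * Cconj d)%C.
Proof.
  intros [_ Hg] Hf. split. apply is_linear_scal_l.
  intros x Hx. assert (Ex := is_filter_lim_locally_unique (K := R_AbsRing) (V := AbsRing_NormedModule R_AbsRing) t x Hx). subst x.
  specialize (Hg t (fun P HP => HP)).
  intros [eps He]. simpl.
  set (M := Cmod a + Cmod b + 1). set (D := Cmod d + 1).
  assert (HM : 0 < M) by (generalize (Cmod_ge_0 a), (Cmod_ge_0 b); unfold M; lra).
  assert (HD : 0 < D) by (generalize (Cmod_ge_0 d); unfold D; lra).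
  assert (He1 : 0 < eps / 2 / M) by (apply Rdiv_lt_0_compat; lra).
  assert (He2 : 0 < eps / 2 / D) by (apply Rdiv_lt_0_compat; lra).
  assert (Gc : filterlim g (locally t) (@locally C_UniformSpace (g t))).
  { apply (ex_derive_continuous (K := R_AbsRing) (V := C_R_NormedModule) g t).
    exists d. split. apply is_linear_scal_l.
    intros y Hy. assert (Ey := is_filter_lim_locally_unique (K := R_AbsRing) (V := AbsRing_NormedModule R_AbsRing) t y Hy). subst y. exact Hg. }
  generalize (filter_and _ _ (filter_and _ _ (Hg (mkposreal _ Rlt_0_1)) (Hg (mkposreal _ He1))) (Gc _ (Hf _ He2))).
  apply filter_imp. simpl. intros s [[H1 H2] H3].
  rewrite norm_increment in H1, H2 |- *.
  change (norm (minus s t)) with (Rabs (s - t)) in *.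
  change (minus s t) with (s - t) in *.
  set (h := (s - t)%R) in *. set (k := (g s - g t)%C) in *.
  set (e := (k - RtoC h * d)%C) in *.
  assert (Hk : Cmod k <= D * Rabs h).
  { replace k with (e + RtoC h * d)%C by (unfold e; ring).
    eapply Rle_trans. apply Cmod_triangle. rewrite Cmod_mult, Cmod_R. unfold D. lra. }
  replace (f (g s) - f (g t) - RtoC h * (a * d + b * Cconj d))%C with
    ((f (g s) - f (g t) - (a * k + b * Cconj k)) + (a * e + b * Cconj e))%C.
  2:{ unfold e. rewrite Cminus_conj, Cmult_conj, Cconj_RtoC. ring. }
  eapply Rle_trans. apply Cmod_triangle.
  assert (Ha : Cmod (a * e + b * Cconj e) <= M * Cmod e).
  { eapply Rle_trans. apply Cmod_triangle. rewrite !Cmod_mult, Cmod_conj.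
    unfold M. generalize (Cmod_ge_0 e). lra. }
  assert (Hb : M * Cmod e <= eps / 2 * Rabs h).
  { replace (eps / 2 * Rabs h) with (M * (eps / 2 / M * Rabs h)) by (field; lra).
    apply Rmult_le_compat_l; lra. }
  assert (Hc : eps / 2 / D * Cmod k <= eps / 2 * Rabs h).
  { replace (eps / 2 * Rabs h) with (eps / 2 / D * (D * Rabs h)) by (field; lra).
    apply Rmult_le_compat_l; lra. }
  lra.
Qed.

(** * Smooth complex functions *)

(** Recursion on Wirtinger derivatives, which are only asked to exist on [U]. Unlike
    [Ck], whose partial derivatives are those of real functions, this notion is
    visibly stable under products, composition and inversion. *)
Fixpoint CkC (n : nat) (U : C -> Prop) (f : C -> C) : Prop :=
  match n with
  | O => forall z, U z -> ccont f z
  | S m => exists a b : C -> C,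
      (forall z, U z -> rdiff f z (a z) (b z)) /\ CkC m U a /\ CkC m U b
  end.

Definition smoothC (U : C -> Prop) (f : C -> C) : Prop := forall n, CkC n U f.

Lemma CkC_pred n U f : CkC (S n) U f -> CkC n U f.
Proof.
  revert f. induction n as [|n IH]; intros f [a [b [H [Ha Hb]]]].
  - intros z Hz. exact (rdiff_ccont _ _ _ _ (H z Hz)).
  - exists a, b. auto.
Qed.

Lemma CkC_ccont n U f z : CkC n U f -> U z -> ccont f z.
Proof. revert f. induction n as [|n IH]; intros f H Hz. exact (H z Hz). apply IH; auto. now apply CkC_pred. Qed.

Lemma open_near U z : open U -> U z -> near z U.
Proof. intros H. apply H. Qed.

Lemma CkC_ext n U f g : open U -> (forall z, U z -> f z = g z) -> CkC n U f -> CkC n U g.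
Proof.
  intros HU E. assert (E' : forall z, U z -> near z (fun w => f w = g w)).
  { intros z Hz. generalize (open_near _ _ HU Hz). apply near_imp. exact E. }
  destruct n as [|n].
  - intros H z Hz. apply (ccont_ext f). auto. auto.
  - intros [a [b [H [Ha Hb]]]]. exists a, b. split; auto.
    intros z Hz. apply (rdiff_ext f); auto.
Qed.

Lemma CkC_sub n (U V : C -> Prop) f : (forall z, V z -> U z) -> CkC n U f -> CkC n V f.
Proof.
  intros HVU. revert f. induction n as [|n IH]; intros f.
  - intros H z Hz. auto.
  - intros [a [b [H [Ha Hb]]]]. exists a, b. auto.
Qed.

Lemma CkC_const n U c : CkC n U (fun _ => c).
Proof.
  revert c. induction n as [|n IH]; intros c.
  - intros z _. exact (rdiff_ccont _ _ _ _ (rdiff_const c z)).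
  - exists (fun _ => RtoC 0), (fun _ => RtoC 0). split; auto. intros z _. apply rdiff_const.
Qed.

Lemma ccont_comp f g z : ccont f z -> ccont g (f z) -> ccont (fun w => g (f w)) z.
Proof. intros Hf Hg eps He. exact (ccont_near _ _ _ Hf (Hg eps He)). Qed.

Lemma ccont_Cconj z : ccont Cconj z.
Proof. exact (rdiff_ccont _ _ _ _ (rdiff_Cconj z)). Qed.

Lemma ccont_plus f g z : ccont f z -> ccont g z -> ccont (fun w => f w + g w)%C z.
Proof.
  intros Hf Hg eps He. assert (He2 : 0 < eps / 2) by lra.
  generalize (near_and _ _ _ (Hf _ He2) (Hg _ He2)). apply near_imp. intros w [H1 H2].
  replace (f w + g w - (f z + g z))%C with ((f w - f z) + (g w - g z))%C by ring.
  eapply Rle_lt_trans. apply Cmod_triangle. lra.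
Qed.

Lemma ccont_mult f g z : ccont f z -> ccont g z -> ccont (fun w => f w * g w)%C z.
Proof.
  intros Hf Hg.
  assert (Sq : forall h, ccont h z -> ccont (fun w => h w * h w)%C z).
  { intros h Hh. exact (ccont_comp h _ z Hh (rdiff_ccont _ _ _ _ (rdiff_sqr (h z)))). }
  assert (Sc : forall k h, ccont h z -> ccont (fun w => k * h w)%C z).
  { intros k h Hh. apply (ccont_comp h (fun w => k * w)%C z Hh).
    exact (rdiff_ccont _ _ _ _ (rdiff_scal k _ _ _ _ (rdiff_id (h z)))). }
  eapply ccont_ext. 2: exact (Sc (/4)%C _ (ccont_plus _ _ _ (Sq _ (ccont_plus _ _ _ Hf Hg))
    (Sc (-1)%C _ (Sq _ (ccont_plus _ _ _ Hf (Sc (-1)%C _ Hg)))))).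
  apply filter_forall. intros w. simpl. field.
Qed.

Lemma CkC_plus n U f g : CkC n U f -> CkC n U g -> CkC n U (fun z => f z + g z)%C.
Proof.
  revert f g. induction n as [|n IH]; intros f g.
  - intros Hf Hg z Hz. apply ccont_plus; auto.
  - intros [a [b [H [Ha Hb]]]] [c [d [H' [Hc Hd]]]].
    exists (fun z => a z + c z)%C, (fun z => b z + d z)%C. split; auto.
    intros z Hz. apply rdiff_plus; auto.
Qed.

Lemma CkC_conj n U f : CkC n U f -> CkC n U (fun z => Cconj (f z)).
Proof.
  revert f. induction n as [|n IH]; intros f.
  - intros Hf z Hz. apply (ccont_comp f). auto. apply ccont_Cconj.
  - intros [a [b [H [Ha Hb]]]]. exists (fun z => Cconj (b z)), (fun z => Cconj (a z)). split; auto.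
    intros z Hz. apply rdiff_conj; auto.
Qed.

Lemma CkC_mult n U f g : CkC n U f -> CkC n U g -> CkC n U (fun z => f z * g z)%C.
Proof.
  revert f g. induction n as [|n IH]; intros f g.
  - intros Hf Hg z Hz. apply ccont_mult; auto.
  - intros Hf Hg. assert (Hf' := CkC_pred _ _ _ Hf). assert (Hg' := CkC_pred _ _ _ Hg).
    destruct Hf as [a [b [H [Ha Hb]]]], Hg as [c [d [H' [Hc Hd]]]].
    exists (fun z => a z * g z + f z * c z)%C, (fun z => b z * g z + f z * d z)%C. split.
    + intros z Hz. apply rdiff_mult; auto.
    + split; apply CkC_plus; auto.
Qed.

Lemma CkC_comp n U V f g : (forall z, U z -> V (f z)) ->
  CkC n U f -> CkC n V g -> CkC n U (fun z => g (f z)).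
Proof.
  intros HUV. revert g. induction n as [|n IH]; intros g Hf Hg.
  - intros z Hz. apply ccont_comp; auto.
  - assert (Hf' := CkC_pred _ _ _ Hf).
    destruct Hf as [a [b [H [Ha Hb]]]], Hg as [c [d [H' [Hc Hd]]]].
    exists (fun z => c (f z) * a z + d (f z) * Cconj (b z))%C,
      (fun z => c (f z) * b z + d (f z) * Cconj (a z))%C. split.
    + intros z Hz. apply rdiff_comp; auto.
    + split; apply CkC_plus; apply CkC_mult; auto using CkC_conj.
Qed.

Lemma CkC_Cinv n : CkC n (fun z => z <> 0) Cinv.
Proof.
  induction n as [|n IH].
  - intros z Hz. exact (rdiff_ccont _ _ _ _ (rdiff_Cinv z Hz)).
  - exists (fun z => -1 * (/ z * / z))%C, (fun _ => RtoC 0). split.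
    + intros z Hz. eapply rdiff_eq. exact (rdiff_Cinv z Hz). ring. ring.
    + split. apply CkC_mult. apply CkC_const. apply CkC_mult; exact IH. apply CkC_const.
Qed.

(** The derivative of [sqrt] is a multiple of its reciprocal, so the order of smoothness
    is raised by one with the help of [CkC_Cinv]. *)
Lemma CkC_sqrt n : CkC n (fun z => 0 < Re z) (fun z => RtoC (sqrt (Re z))).
Proof.
  assert (D : forall z, 0 < Re z -> rdiff (fun z => RtoC (sqrt (Re z))) z
    (/ 4 * / RtoC (sqrt (Re z))) (/ 4 * / RtoC (sqrt (Re z)))).
  { intros z Hz. assert (Hs := sqrt_lt_R0 _ Hz).
    assert (Hs0 : RtoC (sqrt (Re z)) <> 0) by (intros E; apply RtoC_inj in E; lra).
    assert (E : RtoC (/ (2 * sqrt (Re z))) = (/ (2 * RtoC (sqrt (Re z))))%C).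
    { rewrite RtoC_inv, RtoC_mult by lra. reflexivity. }
    eapply rdiff_eq. apply (rdiff_real sqrt z (/ (2 * sqrt (Re z)))).
    - apply is_derive_Reals, derivable_pt_lim_sqrt; exact Hz.
    - rewrite E. field. auto.
    - rewrite E. field. auto. }
  induction n as [|n IH].
  - intros z Hz. exact (rdiff_ccont _ _ _ _ (D z Hz)).
  - exists (fun z => / 4 * / RtoC (sqrt (Re z)))%C, (fun z => / 4 * / RtoC (sqrt (Re z)))%C.
    split. exact D.
    assert (H : CkC n (fun z => 0 < Re z) (fun z => / 4 * / RtoC (sqrt (Re z)))%C).
    { apply CkC_mult. apply CkC_const. apply (CkC_comp n _ (fun z => z <> 0) (fun z => RtoC (sqrt (Re z))) Cinv).
      - intros z Hz E. apply RtoC_inj in E. assert (Hs := sqrt_lt_R0 _ Hz). lra.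
      - exact IH.
      - apply CkC_Cinv. }
    auto.
Qed.

Lemma is_derive_Re g t d : is_derive (K := R_AbsRing) (V := C_R_NormedModule) g t d ->
  is_derive (fun s => Re (g s)) t (Re d).
Proof.
  intros H. eapply filterdiff_ext_lin.
  apply (filterdiff_comp' (K := R_AbsRing) (V := C_R_NormedModule) g (fun w : C => fst w) t _ (fun w : C => fst w) H).
  apply (filterdiff_linear (K := R_AbsRing) (U := C_R_NormedModule)), is_linear_fst.
  reflexivity.
Qed.

Lemma is_derive_Im g t d : is_derive (K := R_AbsRing) (V := C_R_NormedModule) g t d ->
  is_derive (fun s => Im (g s)) t (Im d).
Proof.
  intros H. eapply filterdiff_ext_lin.
  apply (filterdiff_comp' (K := R_AbsRing) (V := C_R_NormedModule) g (fun w : C => snd w) t _ (fun w : C => snd w) H).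
  apply (filterdiff_linear (K := R_AbsRing) (U := C_R_NormedModule)), is_linear_snd.
  reflexivity.
Qed.

Lemma is_derive_pair (x y : R -> R) t (dx dy : R) : is_derive x t dx -> is_derive y t dy ->
  is_derive (K := R_AbsRing) (V := C_R_NormedModule) (fun s => (x s, y s)) t (dx, dy).
Proof.
  intros Hx Hy.
  apply (filterdiff_ext_lin (K := R_AbsRing) (U := AbsRing_NormedModule R_AbsRing) (V := C_R_NormedModule) _ (fun u : R => (u * dx, u * dy))).
  - apply (filterdiff_comp'_2 (K := R_AbsRing) (W := C_R_NormedModule) x y (fun a b => (a, b))
      t _ _ (fun a b => (a, b)) Hx Hy).
    apply (filterdiff_ext (K := R_AbsRing) (V := C_R_NormedModule) (fun w : prod_NormedModule R_AbsRing R_NormedModule R_NormedModule => w)).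
    { intros [a b]. reflexivity. }
    apply (filterdiff_ext_lin (K := R_AbsRing) (V := C_R_NormedModule) _ (fun w => w)).
    apply filterdiff_id. intros [a b]. reflexivity.
  - reflexivity.
Qed.

(** * Partial derivatives *)

Lemma rdiff_x f z a b : rdiff f z a b ->
  is_derive (K := R_AbsRing) (V := C_R_NormedModule) (fun t => f (t, Im z)) (Re z) (a + b)%C.
Proof.
  intros H. destruct z as [x y]. simpl.
  replace (a + b)%C with (a * (1, 0) + b * Cconj (1, 0))%C.
  2:{ apply injective_projections; unfold Cconj; simpl; ring. }
  apply (rdiff_along f (fun t => (t, y)) x); auto.
  apply is_derive_pair. apply (is_derive_id (K := R_AbsRing)). apply (is_derive_const (K := R_AbsRing) (V := R_NormedModule)).
Qed.

Lemma rdiff_y f z a b : rdiff f z a b ->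
  is_derive (K := R_AbsRing) (V := C_R_NormedModule) (fun t => f (Re z, t)) (Im z) (Ci * (a - b))%C.
Proof.
  intros H. destruct z as [x y]. simpl.
  replace (Ci * (a - b))%C with (a * (0, 1) + b * Cconj (0, 1))%C.
  2:{ apply injective_projections; unfold Cconj; simpl; ring. }
  apply (rdiff_along f (fun t => (x, t)) y); auto.
  apply is_derive_pair. apply (is_derive_const (K := R_AbsRing) (V := R_NormedModule)). apply (is_derive_id (K := R_AbsRing)).
Qed.

(** The Wirtinger derivatives that are defined through partial derivatives are the
    coefficients of the differential, which are therefore unique. *)
Lemma rdiff_dz f z a b : rdiff f z a b -> dz f z = a /\ dzbar f z = b.
Proof.
  intros H.
  assert (Ex : CDx f z = (a + b)%C).
  { apply injective_projections; apply is_derive_unique.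
    exact (is_derive_Re _ _ _ (rdiff_x _ _ _ _ H)). exact (is_derive_Im _ _ _ (rdiff_x _ _ _ _ H)). }
  assert (Ey : CDy f z = (Ci * (a - b))%C).
  { apply injective_projections; apply is_derive_unique.
    exact (is_derive_Re _ _ _ (rdiff_y _ _ _ _ H)). exact (is_derive_Im _ _ _ (rdiff_y _ _ _ _ H)). }
  unfold dz, dzbar. rewrite Ex, Ey.
  assert (E2 : (2:C) <> 0) by (intros E; apply RtoC_inj in E; lra).
  split; apply injective_projections; simpl; field.
Qed.

Lemma rdiff_unique f z a b a' b' : rdiff f z a b -> rdiff f z a' b' -> a = a' /\ b = b'.
Proof.
  intros H H'. destruct (rdiff_dz _ _ _ _ H) as [<- <-], (rdiff_dz _ _ _ _ H') as [<- <-]. auto.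
Qed.

Lemma CkC_dz n U f : open U -> CkC (S n) U f ->
  (forall z, U z -> rdiff f z (dz f z) (dzbar f z)) /\ CkC n U (dz f) /\ CkC n U (dzbar f).
Proof.
  intros HU [a [b [H [Ha Hb]]]].
  assert (E : forall z, U z -> dz f z = a z /\ dzbar f z = b z).
  { intros z Hz. apply rdiff_dz. auto. }
  split; [|split].
  - intros z Hz. destruct (E z Hz) as [-> ->]. auto.
  - apply (CkC_ext n U a); auto. intros z Hz. symmetry. apply E; auto.
  - apply (CkC_ext n U b); auto. intros z Hz. symmetry. apply E; auto.
Qed.

Lemma smoothC_dz U f : open U -> smoothC U f ->
  (forall z, U z -> rdiff f z (dz f z) (dzbar f z)) /\ smoothC U (dz f) /\ smoothC U (dzbar f).
Proof.
  intros HU H. split; [|split].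
  - apply (CkC_dz 0 U f HU (H 1%nat)).
  - intros n. apply (CkC_dz n U f HU (H (S n))).
  - intros n. apply (CkC_dz n U f HU (H (S n))).
Qed.

Lemma ccont_continuous f z : ccont f z <-> continuous (T := C_UniformSpace) (U := C_UniformSpace) f z.
Proof.
  split.
  - intros H P HP. apply (ccont_near f z P H HP).
  - intros H eps He. apply (H (fun w => Cmod (w - f z) < eps)). apply (near_disc (f z) eps He).
Qed.

Lemma continuous_Re_C (z : C) : continuous (T := C_UniformSpace) (U := R_UniformSpace) Re z.
Proof. destruct z. apply continuous_fst. Qed.
Lemma continuous_Im_C (z : C) : continuous (T := C_UniformSpace) (U := R_UniformSpace) Im z.
Proof. destruct z. apply continuous_snd. Qed.

Lemma ccont_ofR (f : C -> R) z : ccont (ofR f) z <-> continuous f z.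
Proof.
  rewrite ccont_continuous. split.
  - intros H. apply (continuous_comp (ofR f) Re). exact H. apply continuous_Re_C.
  - intros H P [d Hd].
    assert (L : near z (fun w => ball (f z) d (f w))) by exact (H _ (locally_ball (f z) d)).
    revert L. change (near z (fun w => ball (f z) d (f w)) -> near z (fun w => P (ofR f w))).
    apply near_imp. intros w Hw. apply Hd. split. exact Hw. apply ball_center.
Qed.

Lemma Ck_ext n U f g : open U -> (forall z, U z -> f z = g z) -> Ck n U f -> Ck n U g.
Proof.
  intros HU. revert f g. induction n as [|n IH]; intros f g E.
  - intros H z Hz. apply (continuous_ext_loc g f z). 2: exact (H z Hz).
    generalize (open_near _ _ HU Hz). apply near_imp. intros w Hw; now rewrite E.
  - assert (EX : forall x y, U (x, y) -> locally x (fun t => f (t, y) = g (t, y))).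
    { intros x y Hz. assert (L := HU _ Hz).
      destruct L as [d Hd]. exists d. intros t Ht. apply E, Hd.
      split. exact Ht. apply ball_center. }
    assert (EY : forall x y, U (x, y) -> locally y (fun t => f (x, t) = g (x, t))).
    { intros x y Hz. destruct (HU _ Hz) as [d Hd]. exists d. intros t Ht. apply E, Hd.
      split. apply ball_center. exact Ht. }
    intros [H1 [H2 [H3 H4]]]. split; [|split; [|split]].
    + intros [x y] Hz. simpl. destruct (H1 _ Hz) as [A B]. split.
      * apply (ex_derive_ext_loc (fun t => f (t, y))); auto.
      * apply (ex_derive_ext_loc (fun t => f (x, t))); auto.
    + apply (IH f); auto.
    + apply (IH (Defs.Dx f)); auto. intros [x y] Hz. unfold Defs.Dx. simpl. apply Derive_ext_loc; auto.
    + apply (IH (Dy f)); auto. intros [x y] Hz. unfold Dy. simpl. apply Derive_ext_loc; auto.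
Qed.

Lemma Ck_sub n (U V : C -> Prop) f : (forall z, V z -> U z) -> Ck n U f -> Ck n V f.
Proof.
  intros HVU. revert f. induction n as [|n IH]; intros f.
  - intros H z Hz. apply H; auto.
  - intros [H1 [H2 [H3 H4]]]. split; [|split; [|split]]; auto.
Qed.

Lemma Ck_pred n U f : Ck (S n) U f -> Ck n U f.
Proof. intros [_ [H _]]. exact H. Qed.

Lemma Ck_continuous n U f z : Ck n U f -> U z -> continuous f z.
Proof. revert f. induction n as [|n IH]; intros f H Hz. exact (H z Hz). apply IH; auto. now apply Ck_pred. Qed.

Lemma CkC_Ck n U f : open U -> CkC n U f -> Ck n U (fun z => Re (f z)) /\ Ck n U (fun z => Im (f z)).
Proof.
  intros HU. revert f. induction n as [|n IH]; intros f.
  - intros H. split; intros z Hz.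
    + apply (continuous_comp f Re). apply ccont_continuous. auto. apply continuous_Re_C.
    + apply (continuous_comp f Im). apply ccont_continuous. auto. apply continuous_Im_C.
  - intros H. destruct (IH f (CkC_pred _ _ _ H)) as [K1 K2].
    destruct H as [a [b [H [Ha Hb]]]].
    destruct (IH (fun z => a z + b z)%C) as [X1 X2]. now apply CkC_plus.
    destruct (IH (fun z => Ci * (a z + -1 * b z))%C) as [Y1 Y2].
    { apply CkC_mult. apply CkC_const. apply CkC_plus; auto. apply CkC_mult; auto. apply CkC_const. }
    assert (EY : forall z, (Ci * (a z + -1 * b z) = Ci * (a z - b z))%C) by (intros; ring).
    split; split.
    + intros z Hz. split; eexists.
      * exact (is_derive_Re _ _ _ (rdiff_x _ _ _ _ (H z Hz))).
      * exact (is_derive_Re _ _ _ (rdiff_y _ _ _ _ (H z Hz))).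
    + split; [exact K1|split; [refine (Ck_ext _ _ _ _ HU _ X1) | refine (Ck_ext _ _ _ _ HU _ Y1)]]; intros z Hz; symmetry; apply is_derive_unique.
      * exact (is_derive_Re _ _ _ (rdiff_x _ _ _ _ (H z Hz))).
      * rewrite EY. exact (is_derive_Re _ _ _ (rdiff_y _ _ _ _ (H z Hz))).
    + intros z Hz. split; eexists.
      * exact (is_derive_Im _ _ _ (rdiff_x _ _ _ _ (H z Hz))).
      * exact (is_derive_Im _ _ _ (rdiff_y _ _ _ _ (H z Hz))).
    + split; [exact K2|split; [refine (Ck_ext _ _ _ _ HU _ X2) | refine (Ck_ext _ _ _ _ HU _ Y2)]]; intros z Hz; symmetry; apply is_derive_unique.
      * exact (is_derive_Im _ _ _ (rdiff_x _ _ _ _ (H z Hz))).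
      * rewrite EY. exact (is_derive_Im _ _ _ (rdiff_y _ _ _ _ (H z Hz))).
Qed.

(** A function whose partial derivatives exist nearby, one of them being
    continuous, is differentiable; this is how [Ck] yields differentials. *)
Lemma rdiff_of_partials (f : C -> R) (z : C) (p q : C -> R) :
  near z (fun w => is_derive (fun t => f (t, Im w)) (Re w) (p w)) ->
  is_derive (fun t => f (Re z, t)) (Im z) (q z) ->
  continuous p z ->
  rdiff (ofR f) z ((p z - Ci * q z) / 2) ((p z + Ci * q z) / 2).
Proof.
  destruct z as [x y]. intros Hp Hq Hc.
  assert (D := is_derive_filterdiff (fun x y => f (x, y)) x y (fun x y => p (x, y)) (q (x, y))).
  destruct D as [_ D].
  - revert Hp. apply filter_imp. intros [u v]. auto.
  - exact Hq.
  - apply (continuous_ext p). intros [u v]; reflexivity. exact Hc.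
  - specialize (D (x, y) (fun P HP => HP)).
    intros eps He. generalize (D (mkposreal eps He)). apply filter_imp. intros [u v] H.
    simpl in H.
    assert (N : forall h : C, norm (h : prod_NormedModule R_AbsRing R_NormedModule R_NormedModule) = Cmod h).
    { intros [h1 h2]. unfold norm; simpl. unfold prod_norm, Cmod. f_equal. simpl. unfold norm; simpl.
      unfold abs; simpl. rewrite !Rmult_1_r, <- !Rabs_mult, !Rabs_pos_eq by apply Rle_0_sqr. reflexivity. }
    eapply Rle_trans. 2: { eapply Rle_trans. exact H. right. f_equal. apply N. }
    right.
    match goal with |- Cmod ?A = norm ?B => transitivity (Cmod (RtoC B)) end.
    + f_equal. unfold ofR.
      apply injective_projections; simpl; unfold minus, plus, opp, scal; simpl; unfold mult; simpl; field.
    + rewrite Cmod_R. reflexivity.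
Qed.

Lemma Ck_CkC n U f : open U -> Ck n U f -> CkC n U (ofR f).
Proof.
  intros HU. revert f. induction n as [|n IH]; intros f.
  - intros H z Hz. apply ccont_ofR. exact (H z Hz).
  - intros [H [H0 [Hx Hy]]].
    exists (fun z => /2 * (ofR (Defs.Dx f) z + - Ci * ofR (Dy f) z))%C,
      (fun z => /2 * (ofR (Defs.Dx f) z + Ci * ofR (Dy f) z))%C. split; [|split].
    + intros z Hz. eapply rdiff_eq. apply (rdiff_of_partials f z (Defs.Dx f) (Dy f)).
      * generalize (open_near _ _ HU Hz). apply near_imp. intros w Hw.
        apply Derive_correct. apply H; auto.
      * apply Derive_correct. apply H; auto.
      * exact (Ck_continuous _ _ _ _ Hx Hz).
      * unfold ofR. field.
      * unfold ofR. field.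
    + apply CkC_mult. apply CkC_const. apply CkC_plus; auto. apply CkC_mult; auto. apply CkC_const.
    + apply CkC_mult. apply CkC_const. apply CkC_plus; auto. apply CkC_mult; auto. apply CkC_const.
Qed.

Lemma Csmooth_smoothC U f : open U -> smoothC U f -> Csmooth U f.
Proof. intros HU H. split; intros n; apply (CkC_Ck n U f HU (H n)). Qed.

(** * Mean value inequality and contractions *)

Lemma is_derive_segment (x h : C) (t : R) :
  is_derive (K := R_AbsRing) (V := C_R_NormedModule) (fun s => (x + RtoC s * h)%C) t h.
Proof.
  apply (is_derive_ext (K := R_AbsRing) (V := C_R_NormedModule) (fun s => (Re x + s * Re h, Im x + s * Im h))).
  { intros s. apply injective_projections; unfold Re, Im; simpl; ring. }
  destruct h as [h1 h2]. apply is_derive_pair; auto_derive; auto; unfold Re, Im; simpl; ring.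
Qed.

(** There is no mean value theorem for complex values: it is applied to the component
    of [f] in the direction of the increment of [f] itself. *)
Lemma mean_value_ineq f (x y : C) (K : R) (a b : C -> C) :
  (forall t, 0 <= t <= 1 -> let w := (y + RtoC t * (x - y))%C in
     rdiff f w (a w) (b w) /\ Cmod (a w) + Cmod (b w) <= K) ->
  Cmod (f x - f y) <= K * Cmod (x - y).
Proof.
  intros H. set (h := (x - y)%C) in *. set (c := (f x - f y)%C).
  set (g := fun t => (y + RtoC t * h)%C).
  assert (D : forall t, 0 <= t <= 1 -> is_derive (fun s => Re (Cconj c * f (g s))%C) t
    (Re (Cconj c * (a (g t) * h + b (g t) * Cconj h))%C)).
  { intros t Ht. destruct (H t Ht) as [Hd _]. apply (is_derive_Re (fun s => Cconj c * f (g s))%C).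
    assert (E := rdiff_along _ g t _ _ h (is_derive_segment y h t) (rdiff_scal (Cconj c) _ _ _ _ Hd)).
    cbv beta in E.
    replace (Cconj c * (a (g t) * h + b (g t) * Cconj h))%C with
      (Cconj c * a (g t) * h + Cconj c * b (g t) * Cconj h)%C by ring. exact E. }
  destruct (MVT_gen (fun s => Re (Cconj c * f (g s))%C) 0 1
    (fun t => Re (Cconj c * (a (g t) * h + b (g t) * Cconj h))%C)) as [t [Ht E]].
  - intros t. rewrite Rmin_left, Rmax_right by lra. intros Ht. apply D. lra.
  - intros t. rewrite Rmin_left, Rmax_right by lra. intros Ht.
    apply continuity_pt_filterlim. apply (ex_derive_continuous (K := R_AbsRing) (V := R_NormedModule)).
    eexists. apply D. lra.
  - rewrite Rmin_left, Rmax_right in Ht by lra.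
    destruct (H t Ht) as [_ Hb]. fold (g t) in Hb.
    assert (G1 : g 1 = x) by (unfold g, h; ring).
    assert (G0 : g 0 = y) by (unfold g, h; ring).
    rewrite G1, G0 in E.
    assert (E1 : Re (Cconj c * f x)%C - Re (Cconj c * f y)%C = Cmod c ^ 2).
    { rewrite Cmod2_alt. unfold c, Re, Im; simpl. ring. }
    rewrite E1 in E.
    assert (B : Cmod c ^ 2 <= Cmod c * (K * Cmod h)).
    { rewrite E. rewrite Rminus_0_r, Rmult_1_r. eapply Rle_trans. apply Rle_abs.
      eapply Rle_trans. apply re_le_Cmod. rewrite Cmod_mult, Cmod_conj.
      apply Rmult_le_compat_l. apply Cmod_ge_0.
      eapply Rle_trans. apply Cmod_triangle. rewrite !Cmod_mult, Cmod_conj.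
      generalize (Cmod_ge_0 h). nra. }
    assert (C0 := Cmod_ge_0 c). destruct C0 as [C0|C0].
    + apply Rmult_le_reg_l with (Cmod c); auto. lra.
    + rewrite <- C0. generalize (Cmod_ge_0 h), (Cmod_ge_0 (a (g t))), (Cmod_ge_0 (b (g t))). nra.
Qed.

Lemma Cdisc_segment c r x y t : Cdisc c r x -> Cdisc c r y -> 0 <= t <= 1 ->
  Cdisc c r (y + RtoC t * (x - y))%C.
Proof.
  unfold Cdisc. intros Hx Hy Ht.
  replace (y + RtoC t * (x - y) - c)%C with (RtoC t * (x - c) + RtoC (1 - t) * (y - c))%C.
  2:{ rewrite RtoC_minus. ring. }
  eapply Rle_lt_trans. apply Cmod_triangle. rewrite !Cmod_mult, !Cmod_R, !Rabs_pos_eq by lra.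
  set (X := Cmod (x - c)) in *. set (Y := Cmod (y - c)) in *.
  destruct (Req_dec t 0) as [->|]. lra. nra.
Qed.

Lemma Cdisc_open c r : open (Cdisc c r).
Proof.
  intros z Hz. unfold Cdisc in Hz. apply near_Cmod. exists (r - Cmod (z - c)). split. lra.
  intros w Hw. unfold Cdisc. replace (w - c)%C with ((w - z) + (z - c))%C by ring.
  eapply Rle_lt_trans. apply Cmod_triangle. lra.
Qed.

Lemma Cdisc_center c r : 0 < r -> Cdisc c r c.
Proof. intros H. unfold Cdisc. replace (c - c)%C with (RtoC 0) by ring. rewrite Cmod_0. exact H. Qed.

Lemma C_complete (x : nat -> C) (M : R) :
  (forall n, Cmod (x (S n) - x n) <= M * (/2) ^ n) ->
  exists l, forall eps, 0 < eps -> exists n, Cmod (x n - l) < eps /\ Cmod (x (S n) - l) < eps.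
Proof.
  intros H.
  assert (Hs : ex_series (V := C_R_NormedModule) (fun n => (x (S n) - x n)%C)).
  { apply (ex_series_le (V := C_R_CompleteNormedModule) _ (fun n => M * (/2) ^ n)).
    - intros n. change (norm ((x (S n) - x n)%C : C_R_NormedModule) <= M * (/2) ^ n).
      eapply Rle_trans. 2: apply H. right.
      unfold norm; simpl. unfold prod_norm, Cmod. f_equal. simpl. unfold norm; simpl.
      unfold abs; simpl. rewrite !Rmult_1_r, <- !Rabs_mult, !Rabs_pos_eq by apply Rle_0_sqr. reflexivity.
    - apply (ex_series_scal_l (K := R_AbsRing) M (fun n => (/2) ^ n)). apply ex_series_geom. rewrite Rabs_pos_eq; lra. }
  destruct Hs as [s Hs].
  exists (x O + s)%C. intros eps He.
  assert (T : forall n, sum_n (G := C_R_NormedModule) (fun n => (x (S n) - x n)%C) n = (x (S n) - x O)%C).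
  { induction n as [|n IH]. rewrite sum_O. reflexivity. rewrite sum_Sn, IH.
    change ((x (S n) - x 0%nat) + (x (S (S n)) - x (S n)) = x (S (S n)) - x 0%nat)%C. ring. }
  assert (L := Hs (fun w => Cmod (w - s) < eps)).
  destruct L as [N HN]. { apply (near_disc s eps He). }
  exists (S N). split.
  - specialize (HN N (Nat.le_refl _)). rewrite T in HN.
    replace (x (S N) - (x O + s))%C with (x (S N) - x O - s)%C by ring. exact HN.
  - specialize (HN (S N) (Nat.le_succ_diag_r _)). rewrite T in HN.
    replace (x (S (S N)) - (x O + s))%C with (x (S (S N)) - x O - s)%C by ring. exact HN.
Qed.

Lemma Cmod_small_eq (x y : C) : (forall eps, 0 < eps -> Cmod (x - y) <= eps) -> x = y.
Proof.
  intros H. assert (E : Cmod (x - y) = 0).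
  { destruct (Cmod_ge_0 (x - y)) as [P|P]; auto. specialize (H (Cmod (x - y) / 2)). lra. }
  apply Cmod_eq_0 in E. replace x with (x - y + y)%C by ring. rewrite E. ring.
Qed.

Lemma contraction_fixpoint (T : C -> C) (p : C) (r : R) :
  (forall x y, Cmod (x - p) <= r -> Cmod (y - p) <= r -> Cmod (T x - T y) <= /2 * Cmod (x - y)) ->
  Cmod (T p - p) <= r / 2 -> exists x, Cmod (x - p) <= r /\ T x = x.
Proof.
  intros HT Hp. assert (Hr : 0 <= r) by (generalize (Cmod_ge_0 (T p - p)); lra).
  assert (Hpp : Cmod (p - p) <= r).
  { replace (p - p)%C with (RtoC 0) by ring. rewrite Cmod_0. exact Hr. }
  set (x := fun n => Nat.iter n T p).
  assert (B : forall n, Cmod (x n - p) <= r).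
  { induction n as [|n IH]. exact Hpp.
    change (x (S n)) with (T (x n)). replace (T (x n) - p)%C with ((T (x n) - T p) + (T p - p))%C by ring.
    eapply Rle_trans. apply Cmod_triangle. specialize (HT _ _ IH Hpp). lra. }
  assert (Cy : forall n, Cmod (x (S n) - x n) <= r / 2 * (/2) ^ n).
  { induction n as [|n IH]. simpl. lra.
    change (x (S (S n))) with (T (x (S n))). change (x (S n)) with (T (x n)) at 2.
    specialize (HT _ _ (B (S n)) (B n)). simpl pow. lra. }
  destruct (C_complete x _ Cy) as [l Hl].
  assert (Bl : Cmod (l - p) <= r).
  { apply le_epsilon. intros eps He. destruct (Hl eps He) as [n [Hn _]].
    replace (l - p)%C with ((l - x n) + (x n - p))%C by ring.
    eapply Rle_trans. apply Cmod_triangle. rewrite Cmod_minus_sym. specialize (B n). lra. }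
  exists l. split; auto. apply Cmod_small_eq. intros eps He.
  destruct (Hl (eps / 2)) as [n [H1 H2]]. lra.
  replace (T l - l)%C with ((T l - T (x n)) + (x (S n) - l))%C by (simpl; unfold x; simpl; ring).
  eapply Rle_trans. apply Cmod_triangle. specialize (HT _ _ Bl (B n)).
  rewrite (Cmod_minus_sym l) in HT. generalize (Cmod_ge_0 (x n - l)). lra.
Qed.

(** * The inverse function theorem in the plane *)

(** The Jacobian determinant of [f] as a map of the plane; it is real
    ([Jac_real]) but kept in [C], where it is used as a divisor. *)
Definition Jac (f : C -> C) (z : C) : C :=
  (dz f z * Cconj (dz f z) - dzbar f z * Cconj (dzbar f z))%C.

Lemma ccont_small f z eps : ccont f z -> f z = 0 -> 0 < eps -> near z (fun w => Cmod (f w) < eps).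
Proof.
  intros H E He. generalize (H eps He). apply near_imp. intros w. rewrite E.
  replace (f w - 0)%C with (f w) by ring. auto.
Qed.

Lemma ccont_neq0 f z : ccont f z -> f z <> 0 -> near z (fun w => f w <> 0).
Proof.
  intros H E. generalize (H _ (proj1 (Cmod_gt_0 _) E)). apply near_imp. intros w Hw Ew.
  rewrite Ew in Hw. replace (0 - f z)%C with (- f z)%C in Hw by ring. rewrite Cmod_opp in Hw. lra.
Qed.

Lemma smoothC_Jac U f : open U -> smoothC U f -> smoothC U (Jac f).
Proof.
  intros HU Hf n. destruct (smoothC_dz U f HU Hf) as [_ [Ha Hb]].
  apply (CkC_ext n U (fun z => dz f z * Cconj (dz f z) + -1 * (dzbar f z * Cconj (dzbar f z)))%C); auto.
  - intros z _. unfold Jac. ring.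
  - apply CkC_plus. apply CkC_mult; auto using CkC_conj.
    apply CkC_mult. apply CkC_const. apply CkC_mult; auto using CkC_conj.
Qed.

Lemma Jac_real f z : Cconj (Jac f z) = Jac f z.
Proof. unfold Jac. rewrite Cminus_conj, !Cmult_conj, !Cconj_conj. ring. Qed.

(** [L] is the inverse of the differential at [p], so the differential of
    [x |-> x - L (f x)] vanishes at [p] and is small nearby. *)
Lemma newton_map_contraction U f p : open U -> smoothC U f -> U p -> Jac f p <> 0 ->
  exists d M, 0 < d /\ 0 < M /\ exists L : C -> C,
    (forall k l, L (k - l)%C = (L k - L l)%C) /\ (forall k, Cmod (L k) <= M * Cmod k) /\
    (forall k, L k = 0 -> k = 0) /\
    (forall x, Cdisc p d x -> U x /\ Jac f x <> 0) /\
    forall x y, Cdisc p d x -> Cdisc p d y ->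
      Cmod ((x - L (f x)) - (y - L (f y))) <= /2 * Cmod (x - y).
Proof.
  intros HU Hf Hp HJ. destruct (smoothC_dz U f HU Hf) as [D [Ha Hb]].
  set (a0 := dz f p) in *. set (b0 := dzbar f p) in *. set (J := Jac f p) in *.
  set (L := fun k => (/ J * (Cconj a0 * k + - b0 * Cconj k))%C).
  set (A := fun x => (1 + -1 * (/ J * (Cconj a0 * dz f x + - b0 * Cconj (dzbar f x))))%C).
  set (B := fun x => (-1 * (/ J * (Cconj a0 * dzbar f x + - b0 * Cconj (dz f x))))%C).
  assert (DL : forall k, rdiff L k (/ J * Cconj a0) (/ J * - b0)).
  { intros k. unfold L. eapply rdiff_eq. apply rdiff_scal. apply rdiff_plus.
    apply rdiff_scal, rdiff_id. apply rdiff_scal, rdiff_Cconj. ring. ring. }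
  assert (DN : forall x, U x -> rdiff (fun x => x + -1 * L (f x))%C x (A x) (B x)).
  { intros x Hx. eapply rdiff_eq. apply rdiff_plus. apply rdiff_id. apply rdiff_scal.
    exact (rdiff_comp f L x _ _ _ _ (D x Hx) (DL (f x))).
    unfold A. ring. unfold B. ring. }
  assert (cA : ccont A p).
  { apply (CkC_ccont 0 U); auto. unfold A.
    apply CkC_plus. apply CkC_const. apply CkC_mult. apply CkC_const. apply CkC_mult. apply CkC_const.
    apply CkC_plus; apply CkC_mult; auto using CkC_conj, CkC_const. }
  assert (cB : ccont B p).
  { apply (CkC_ccont 0 U); auto. unfold B.
    apply CkC_mult. apply CkC_const. apply CkC_mult. apply CkC_const.
    apply CkC_plus; apply CkC_mult; auto using CkC_conj, CkC_const. }
  assert (A0 : A p = 0).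
  { unfold A. fold a0 b0. replace (Cconj a0 * a0 + - b0 * Cconj b0)%C with J by (unfold J, Jac; fold a0 b0; ring).
    field. auto. }
  assert (B0 : B p = 0) by (unfold B; fold a0 b0; ring).
  assert (q : 0 < /4) by lra.
  assert (cJ : ccont (Jac f) p) by (apply (CkC_ccont 0 U); auto; apply smoothC_Jac; auto).
  assert (NN := near_and _ _ _ (near_and _ _ _ (ccont_small A p _ cA A0 q) (ccont_small B p _ cB B0 q))
    (near_and _ _ _ (open_near _ _ HU Hp) (ccont_neq0 _ _ cJ HJ))).
  apply near_Cmod in NN. destruct NN as [d [Hd NN]].
  exists d, (Cmod (/ J * Cconj a0) + Cmod (/ J * - b0) + 1). split; auto. split.
  { generalize (Cmod_ge_0 (/ J * Cconj a0)), (Cmod_ge_0 (/ J * - b0)). lra. }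
  exists L. split; [|split; [|split; [|split]]].
  - intros k l. unfold L. rewrite Cminus_conj. ring.
  - intros k. unfold L.
    replace (/ J * (Cconj a0 * k + - b0 * Cconj k))%C with
      (/ J * Cconj a0 * k + / J * - b0 * Cconj k)%C by ring.
    eapply Rle_trans. apply Cmod_triangle. rewrite (Cmod_mult _ k), (Cmod_mult _ (Cconj k)), Cmod_conj.
    generalize (Cmod_ge_0 k). lra.
  - intros k Hk.
    assert (E : k = (a0 * L k + b0 * Cconj (L k))%C).
    { unfold L. rewrite Cmult_conj, Cinv_conj by auto. rewrite Cplus_conj, !Cmult_conj, Copp_conj, !Cconj_conj.
      assert (EJ : Cconj J = J) by apply Jac_real. rewrite EJ.
      transitivity (/ J * J * k)%C. field; auto.
      unfold J at 2. unfold Jac. fold a0 b0. ring. }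
    rewrite E, Hk. rewrite Cconj_RtoC. ring.
  - intros x Hx. apply (NN x Hx).
  - intros x y Hx Hy.
    replace (x - L (f x))%C with (x + -1 * L (f x))%C by ring.
    replace (y - L (f y))%C with (y + -1 * L (f y))%C by ring.
    apply (mean_value_ineq (fun x => x + -1 * L (f x))%C x y (/2) A B).
    intros t Ht w. destruct (NN w) as [[H1 H2] [H3 _]]. apply Cdisc_segment; auto.
    split. apply DN; auto. lra.
Qed.

(** The inverse of the linear map [h |-> a h + b Cconj h] is
    [k |-> (Cconj a k - b Cconj k) / J]; the Lipschitz bound on [psi] turns
    [o(psi y - psi w)] into [o(y - w)]. *)
Lemma inverse_rdiff f psi w a b (M : R) :
  rdiff f (psi w) a b -> (a * Cconj a - b * Cconj b)%C <> 0 ->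
  near w (fun y => f (psi y) = y) ->
  near w (fun y => Cmod (psi y - psi w) <= M * Cmod (y - w)) ->
  let J := (a * Cconj a - b * Cconj b)%C in
  rdiff psi w (Cconj a / J) (- b / J).
Proof.
  intros Hf HJ Hi HM J eps He.
  set (K := Cmod a + Cmod b + 1).
  assert (HK : 0 < K) by (generalize (Cmod_ge_0 a), (Cmod_ge_0 b); unfold K; lra).
  set (M' := Rabs M + 1). assert (HM' : 0 < M') by (generalize (Rabs_pos M); unfold M'; lra).
  assert (HJ' : 0 < Cmod J) by (apply Cmod_gt_0; exact HJ).
  assert (He' : 0 < eps * Cmod J / K / M').
  { repeat apply Rdiv_lt_0_compat; auto. apply Rmult_lt_0_compat; auto. }
  assert (Hc : ccont psi w).
  { intros e Hel. assert (P : 0 < e / M') by (apply Rdiv_lt_0_compat; auto).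
    generalize (near_and _ _ _ HM (near_disc w _ P)). apply near_imp. unfold Cdisc. intros y [H1 H2].
    apply Rmult_lt_compat_l with (r := M') in H2; auto.
    replace (M' * (e / M')) with e in H2 by (field; lra).
    assert (M * Cmod (y - w) <= M' * Cmod (y - w)).
    { apply Rmult_le_compat_r. apply Cmod_ge_0. unfold M'. generalize (Rle_abs M). lra. }
    lra. }
  generalize (near_and _ _ _ (near_and _ _ _ Hi HM) (ccont_near _ _ _ Hc (Hf _ He'))).
  apply near_imp. intros y [[H1 H2] H3]. rewrite H1, (near_self _ _ Hi) in H3.
  set (h := (psi y - psi w)%C) in *. set (k := (y - w)%C) in *.
  set (r := (k - (a * h + b * Cconj h))%C) in *.
  replace (h - (Cconj a / J * k + - b / J * Cconj k))%C with (- (Cconj a * r + - b * Cconj r) / J)%C.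
  2:{ assert (E : (J * h = Cconj a * k + - b * Cconj k - (Cconj a * r + - b * Cconj r))%C).
      { unfold r, J. rewrite Cminus_conj, Cplus_conj, !Cmult_conj, Cconj_conj. ring. }
      transitivity (J * h / J - (Cconj a / J * k + - b / J * Cconj k))%C.
      - rewrite E. unfold Cdiv. ring.
      - field. exact HJ. }
  rewrite Cmod_div by auto. rewrite Cmod_opp. apply Rle_div_l. auto.
  assert (R1 : Cmod (Cconj a * r + - b * Cconj r) <= K * Cmod r).
  { eapply Rle_trans. apply Cmod_triangle. rewrite !Cmod_mult, Cmod_opp, !Cmod_conj. unfold K.
    generalize (Cmod_ge_0 r). lra. }
  assert (R2 : Cmod h <= M' * Cmod k).
  { eapply Rle_trans. exact H2. apply Rmult_le_compat_r. apply Cmod_ge_0. unfold M'. generalize (Rle_abs M). lra. }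
  assert (R3 : Cmod r <= eps * Cmod J / K * Cmod k).
  { eapply Rle_trans. exact H3.
    replace (eps * Cmod J / K * Cmod k) with (eps * Cmod J / K / M' * (M' * Cmod k)) by (field; lra).
    apply Rmult_le_compat_l; lra. }
  eapply Rle_trans. exact R1.
  replace (eps * Cmod k * Cmod J) with (K * (eps * Cmod J / K * Cmod k)) by (field; lra).
  apply Rmult_le_compat_l; lra.
Qed.

(** The equation [f x = w] is solved by iterating [x |-> x - L (f x - w)], a contraction
    of a disc when [w] is close to [f p]. Contractivity also gives injectivity and a
    Lipschitz bound for the inverse. The derivatives of [psi] are then smooth functions
    of [psi], so that the order of smoothness of [psi] can be raised inductively. *)
Lemma inverse_function U f p : open U -> smoothC U f -> U p -> Jac f p <> 0 ->
  exists (N : C -> Prop) (eta : R) (psi : C -> C), let V := Cdisc (f p) eta in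
    0 < eta /\ open N /\ N p /\ (forall z, N z -> U z) /\
    (forall z, N z -> V (f z) /\ psi (f z) = z) /\
    (forall w, V w -> N (psi w) /\ f (psi w) = w) /\
    smoothC V psi /\
    (forall w, V w -> Jac f (psi w) <> 0 /\
       rdiff psi w (Cconj (dz f (psi w)) / Jac f (psi w)) (- dzbar f (psi w) / Jac f (psi w))).
Proof.
  intros HU Hf Hp HJ.
  destruct (newton_map_contraction U f p HU Hf Hp HJ) as [d [M [Hd [HM [L [Ladd [Lb [L0 [HdU HT]]]]]]]]].
  assert (Inj : forall x y, Cdisc p d x -> Cdisc p d y -> Cmod (x - y) <= 2 * M * Cmod (f x - f y)).
  { intros x y Hx Hy. specialize (HT x y Hx Hy). specialize (Lb (f x - f y)%C).
    assert (Cmod (x - y) <= Cmod (x - L (f x) - (y - L (f y))) + Cmod (L (f x - f y)%C)).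
    { replace (x - y)%C with ((x - L (f x) - (y - L (f y))) + L (f x - f y))%C at 1
        by (rewrite Ladd; ring). apply Cmod_triangle. }
    lra. }
  set (eta := d / (4 * M)). assert (Heta : 0 < eta) by (apply Rdiv_lt_0_compat; lra).
  set (V := Cdisc (f p) eta).
  assert (Sur : forall w, V w -> exists x, Cdisc p d x /\ f x = w).
  { intros w Hw.
    destruct (contraction_fixpoint (fun x => x - L (f x - w))%C p (d / 2)) as [x [Hx Ex]].
    - intros x y Hx Hy. rewrite !Ladd.
      replace (x - (L (f x) - L w) - (y - (L (f y) - L w)))%C with (x - L (f x) - (y - L (f y)))%C by ring.
      apply HT; unfold Cdisc; lra.
    - replace (p - L (f p - w) - p)%C with (- L (f p - w))%C by ring. rewrite Cmod_opp.
      eapply Rle_trans. apply Lb. unfold V, Cdisc in Hw. rewrite Cmod_minus_sym.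
      apply Rlt_le. apply Rlt_le_trans with (M * eta). apply Rmult_lt_compat_l; auto.
      right. unfold eta. field. lra.
    - exists x. split. unfold Cdisc; lra.
      assert (L (f x - w)%C = 0). { replace (L (f x - w)%C) with (x - (x - L (f x - w)))%C by ring. rewrite Ex. ring. }
      apply L0 in H. replace (f x) with ((f x - w) + w)%C by ring. rewrite H. ring. }
  set (psi := fun w => epsilon (inhabits (RtoC 0)) (fun x => Cdisc p d x /\ f x = w)).
  assert (Hpsi : forall w, V w -> Cdisc p d (psi w) /\ f (psi w) = w).
  { intros w Hw. apply epsilon_spec. auto. }
  destruct (smoothC_dz U f HU Hf) as [D [Ha Hb]].
  assert (VO : open V) by apply Cdisc_open.
  assert (Dpsi : forall w, V w -> Jac f (psi w) <> 0 /\
       rdiff psi w (Cconj (dz f (psi w)) / Jac f (psi w)) (- dzbar f (psi w) / Jac f (psi w))).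
  { intros w Hw. destruct (Hpsi w Hw) as [H1 H2]. destruct (HdU _ H1) as [H3 H4].
    split; auto. apply (inverse_rdiff f psi w _ _ (2 * M)); auto.
    - generalize (open_near _ _ VO Hw). apply near_imp. intros y Hy. apply Hpsi; auto.
    - generalize (open_near _ _ VO Hw). apply near_imp. intros y Hy. destruct (Hpsi y Hy) as [H5 H6].
      rewrite <- H6 at 2. rewrite <- H2 at 2. apply Inj; auto. }
  exists (fun x => Cdisc p d x /\ V (f x)), eta, psi. cbv zeta. fold V.
  split; [exact Heta|]. split; [|split; [|split; [|split; [|split; [|split]]]]].
  - intros x [H1 H2]. apply (near_and x). apply (open_near _ _ (Cdisc_open _ _) H1).
    apply ccont_near. apply (CkC_ccont 0 U); auto. apply (HdU x H1). apply (open_near _ _ VO H2).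
  - split; apply Cdisc_center; auto.
  - intros x [H1 _]. apply (HdU x H1).
  - intros x [H1 H2]. split; auto. destruct (Hpsi _ H2) as [H3 H4].
    apply Cmod_small_eq. intros eps He. eapply Rle_trans. apply Inj; auto.
    rewrite H4. replace (f x - f x)%C with (RtoC 0) by ring. rewrite Cmod_0. lra.
  - intros w Hw. destruct (Hpsi w Hw) as [H1 H2]. rewrite H2. auto.
  - intros n. induction n as [|n IH].
    + intros w Hw. apply (rdiff_ccont _ _ _ _ (proj2 (Dpsi w Hw))).
    + assert (SJ : CkC n V (fun w => / Jac f (psi w))%C).
      { apply (CkC_comp n V (fun z => z <> 0) (fun w => Jac f (psi w)) Cinv).
        intros w Hw. apply (Dpsi w Hw).
        apply (CkC_comp n V U psi (Jac f)). intros w Hw. apply (HdU _ (proj1 (Hpsi w Hw))).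
        exact IH. apply smoothC_Jac; auto. apply CkC_Cinv. }
      assert (Scomp : forall g, smoothC U g -> CkC n V (fun w => g (psi w))).
      { intros g Hg. apply (CkC_comp n V U psi g). intros w Hw. apply (HdU _ (proj1 (Hpsi w Hw))).
        exact IH. apply Hg. }
      eexists; eexists. split. intros w Hw. apply (Dpsi w Hw). unfold Cdiv. split.
      * apply CkC_mult; auto. apply CkC_conj. auto.
      * apply CkC_mult; auto. apply (CkC_ext n V (fun w => -1 * dzbar f (psi w))%C); auto. intros; ring.
        apply CkC_mult. apply CkC_const. auto.
  - exact Dpsi.
Qed.

(** * The minimal surface equation and zeta *)

Lemma C2_neq0 : (2 : C) <> 0.
Proof. intros E. apply RtoC_inj in E. lra. Qed.

Lemma Cmult_eq_reg_r (z x y : C) : (x * z)%C = (y * z)%C -> z <> 0 -> x = y.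
Proof.
  intros E H. transitivity (x * z * / z)%C. field; auto. rewrite E. field; auto.
Qed.

Lemma dz_ofR f z : dz (ofR f) z = (/ 2 * Defs.Dx f z, / 2 * - Dy f z).
Proof.
  unfold dz, CDx, CDy, ofR, Defs.Dx, Dy. simpl. rewrite !Derive_const.
  apply injective_projections; simpl; field.
Qed.

Lemma dzbar_ofR f z : dzbar (ofR f) z = Cconj (dz (ofR f) z).
Proof.
  rewrite dz_ofR. unfold dzbar, CDx, CDy, ofR, Defs.Dx, Dy. simpl. rewrite !Derive_const.
  apply injective_projections; simpl; field.
Qed.

Lemma Dx_scal c f z : Defs.Dx (fun w => c * f w) z = c * Defs.Dx f z.
Proof. apply Derive_scal. Qed.
Lemma Dy_scal c f z : Dy (fun w => c * f w) z = c * Dy f z.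
Proof. apply Derive_scal. Qed.
Lemma Dx_opp f z : Defs.Dx (fun w => - f w) z = - Defs.Dx f z.
Proof. apply Derive_opp. Qed.
Lemma Dy_opp f z : Dy (fun w => - f w) z = - Dy f z.
Proof. apply Derive_opp. Qed.

Lemma CDx_CDy_pair (g : C -> C) f h z : (forall w, g w = (/ 2 * f w, / 2 * - h w)) ->
  CDx g z = (/ 2 * Defs.Dx f z, / 2 * - Defs.Dx h z) /\ CDy g z = (/ 2 * Dy f z, / 2 * - Dy h z).
Proof.
  intros E. unfold CDx, CDy. rewrite <- Dx_opp, <- Dy_opp, <- !Dx_scal, <- !Dy_scal.
  unfold Defs.Dx, Dy. split; f_equal; apply Derive_ext; intros t; rewrite E; reflexivity.
Qed.

Lemma dz_dz_ofR f z : dz (dz (ofR f)) z =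
  (/ 4 * (Defs.Dx (Defs.Dx f) z - Dy (Dy f) z), - / 4 * (Defs.Dx (Dy f) z + Dy (Defs.Dx f) z)).
Proof.
  destruct (CDx_CDy_pair _ _ _ z (dz_ofR f)) as [E1 E2]. unfold dz at 1. rewrite E1, E2.
  apply injective_projections; simpl; field.
Qed.

Lemma dzbar_dz_ofR f z : dzbar (dz (ofR f)) z =
  (/ 4 * (Defs.Dx (Defs.Dx f) z + Dy (Dy f) z), / 4 * (Dy (Defs.Dx f) z - Defs.Dx (Dy f) z)).
Proof.
  destruct (CDx_CDy_pair _ _ _ z (dz_ofR f)) as [E1 E2]. unfold dzbar at 1. rewrite E1, E2.
  apply injective_projections; simpl; field.
Qed.

(** Symmetry of second derivatives is what makes [dzbar (dz phi)] a real number. *)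
Lemma mixed_partials U f z : open U -> smooth U f -> U z ->
  Defs.Dx (Dy f) z = Dy (Defs.Dx f) z.
Proof.
  intros HU Hf Hz. destruct z as [x y]. unfold Defs.Dx, Dy. simpl.
  destruct (Hf 2%nat) as [H1 [_ [H2 H3]]].
  apply (Schwarz (fun x y => f (x, y))).
  - assert (L := HU _ Hz). destruct L as [d Hd]. exists d. intros u v Hu Hv.
    assert (Uw : U (u, v)). { apply Hd. split. exact Hu. exact Hv. }
    destruct (H1 _ Uw) as [A1 A2]. destruct H2 as [H2 _], H3 as [H3 _].
    destruct (H2 _ Uw) as [_ A3], (H3 _ Uw) as [A4 _]. simpl in A1, A2, A3, A4. auto.
  - apply continuity_2d_pt_filterlim. destruct H3 as [_ [_ [H3 _]]].
    apply (continuous_ext (Defs.Dx (Dy f))). intros [u v]; reflexivity. exact (H3 _ Hz).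
  - apply continuity_2d_pt_filterlim. destruct H2 as [_ [_ [_ H2]]].
    apply (continuous_ext (Dy (Defs.Dx f))). intros [u v]; reflexivity. exact (H2 _ Hz).
Qed.

(** The equation is [(1 + 2uv) phi_zzbar = u^2 phi_zz + v^2 phi_zbarzbar]. *)
Lemma minimal_surface_wirtinger U phi z : open U -> smooth U phi -> minimal_surface_eq U phi -> U z ->
  let u := dzbar (ofR phi) z in let v := dz (ofR phi) z in
  let k := dz (dz (ofR phi)) z in let m := dzbar (dz (ofR phi)) z in
  Cconj m = m /\ ((1 + 2 * u * v) * m = u * u * k + v * v * Cconj k)%C.
Proof.
  intros HU Hf HM Hz u v k m. specialize (HM z Hz).
  unfold u, v, k, m. rewrite dzbar_ofR, dz_ofR, dz_dz_ofR, dzbar_dz_ofR.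
  rewrite (mixed_partials U phi z) by auto.
  split.
  - apply injective_projections; simpl; field.
  - set (X := Defs.Dx phi z) in *. set (Y := Dy phi z) in *.
    set (E := Defs.Dx (Defs.Dx phi) z) in *. set (F := Dy (Defs.Dx phi) z) in *.
    set (G := Dy (Dy phi) z) in *.
    apply injective_projections; simpl.
    + apply Rminus_diag_uniq.
      (* [/ 4] times the left-hand side of the equation in partial derivatives. *)
      transitivity (/4 * ((1 + Y ^ 2) * E - 2 * X * Y * F + (1 + X ^ 2) * G)).
      field. rewrite HM. ring.
    + field.
Qed.

(** The square root [sqrt (1 + 4 u v)] in the definition of [zeta]. *)
Definition zroot (phi : C -> R) (z : C) : C :=
  RtoC (sqrt (Re (1 + 4 * dzbar (ofR phi) z * dz (ofR phi) z)%C)).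
Lemma zroot_arg phi z : (1 + 4 * dzbar (ofR phi) z * dz (ofR phi) z)%C = RtoC (1 + 4 * Cmod (dz (ofR phi) z) ^ 2).
Proof.
  rewrite dzbar_ofR.
  rewrite RtoC_plus, RtoC_mult.
  replace (RtoC (Cmod (dz (ofR phi) z) ^ 2)) with (dz (ofR phi) z * Cconj (dz (ofR phi) z))%C. ring.
  rewrite Cmod2_alt. apply injective_projections; simpl; unfold Re, Im; ring.
Qed.

Lemma zroot_pos phi z : 1 <= Re (1 + 4 * dzbar (ofR phi) z * dz (ofR phi) z)%C.
Proof. rewrite zroot_arg. unfold Re, RtoC; simpl. generalize (Cmod_ge_0 (dz (ofR phi) z)). nra. Qed.

Lemma zroot_sqr phi z : (zroot phi z * zroot phi z = 1 + 4 * dzbar (ofR phi) z * dz (ofR phi) z)%C.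
Proof.
  assert (H := zroot_pos phi z). unfold zroot. rewrite <- RtoC_mult, sqrt_sqrt by lra.
  rewrite zroot_arg. reflexivity.
Qed.

Lemma zroot_ge1 phi z : exists r, 1 <= r /\ zroot phi z = RtoC r.
Proof.
  eexists; split. 2: reflexivity. rewrite <- sqrt_1 at 1. apply sqrt_le_1_alt. apply zroot_pos.
Qed.

Lemma zroot_den phi z : (1 + zroot phi z)%C <> 0.
Proof.
  destruct (zroot_ge1 phi z) as [r [Hr E]]. rewrite E, <- RtoC_plus. intros H. apply RtoC_inj in H. lra.
Qed.

(** Rationalizing the quotient removes the singularity at [v = 0] and shows that [zeta]
    is smooth. *)
Lemma zeta_alt phi z : zeta phi z = (2 * dzbar (ofR phi) z * / (1 + zroot phi z))%C.
Proof.
  assert (D := zroot_den phi z).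
  unfold zeta. destruct (Ceq_dec (dz (ofR phi) z) 0) as [E|E].
  - rewrite dzbar_ofR, E, Cconj_RtoC. ring.
  - fold (zroot phi z).
    apply Cmult_eq_reg_r with (2 * dz (ofR phi) z * (1 + zroot phi z))%C.
    + transitivity ((zroot phi z * zroot phi z - 1))%C. field. auto.
      rewrite zroot_sqr. field. auto.
    + apply Cmult_neq_0; [apply Cmult_neq_0|]; auto using C2_neq0.
Qed.

(** [zeta] takes values in the open unit disc, and [u] is recovered from it without a
    square root. This is the form in which the relation is differentiated. *)
Lemma zeta_mod phi z : exists r, 0 < r /\ (1 - zeta phi z * Cconj (zeta phi z))%C = RtoC r /\
   dzbar (ofR phi) z = (zeta phi z * / (1 - zeta phi z * Cconj (zeta phi z)))%C.
Proof.
  destruct (zroot_ge1 phi z) as [r [Hr E]]. assert (D := zroot_den phi z). assert (Q := zroot_sqr phi z).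
  assert (Hvu : dz (ofR phi) z = Cconj (dzbar (ofR phi) z)). { rewrite dzbar_ofR, Cconj_conj. reflexivity. }
  assert (H2 : (1 - zeta phi z * Cconj (zeta phi z) = 2 * / (1 + zroot phi z))%C).
  { rewrite zeta_alt. rewrite !Cmult_conj, Cinv_conj by auto. rewrite Cplus_conj, !Cconj_RtoC, <- Hvu.
    replace (Cconj (zroot phi z)) with (zroot phi z) by (rewrite E, Cconj_RtoC; reflexivity).
    transitivity (1 - (1 + 4 * dzbar (ofR phi) z * dz (ofR phi) z - 1) / ((1 + zroot phi z) * (1 + zroot phi z)))%C. field; auto.
    rewrite <- Q. field. auto. }
  exists (2 / (1 + r)). split. apply Rdiv_lt_0_compat; lra. split.
  - rewrite H2, E. rewrite <- RtoC_plus, <- RtoC_inv, <- RtoC_mult by lra. reflexivity.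
  - rewrite H2, zeta_alt. field. auto.
Qed.

Lemma zeta_smooth phi U : open U -> smooth U phi -> smoothC U (zeta phi).
Proof.
  intros HU Hf.
  assert (Hp : smoothC U (ofR phi)) by (intros n; apply Ck_CkC; auto).
  destruct (smoothC_dz U _ HU Hp) as [_ [Hv Hu]]. intros n.
  apply (CkC_ext n U (fun z => 2 * dzbar (ofR phi) z * / (1 + zroot phi z))%C); auto.
  { intros z _. symmetry. apply zeta_alt. }
  apply CkC_mult. apply CkC_mult. apply CkC_const. auto.
  apply (CkC_comp n U (fun z => z <> 0) (fun z => 1 + zroot phi z)%C Cinv).
  - intros z _. apply zroot_den.
  - apply CkC_plus. apply CkC_const. unfold zroot.
    apply (CkC_comp n U (fun z => 0 < Re z) (fun z => 1 + 4 * dzbar (ofR phi) z * dz (ofR phi) z)%C (fun w => RtoC (sqrt (Re w)))).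
    + intros z _. generalize (zroot_pos phi z). lra.
    + apply CkC_plus. apply CkC_const. apply CkC_mult. apply CkC_mult. apply CkC_const. auto. auto.
    + apply CkC_sqrt.
  - apply CkC_Cinv.
Qed.

(** Differentiating [u = zeta / (1 - |zeta|^2)] expresses the second derivatives of [phi]
    through [a = zeta_z] and [b = zeta_zbar]. In these terms the quantity
    [A = a - Cconj zeta ^ 2 b] is real since [phi_zzbar] is, and the minimal surface
    equation becomes [(1 - |zeta|^4) (A + Cconj A) = 0]. The Hessian determinant
    becomes a nonzero multiple of the Jacobian of [zeta]. *)
Lemma zeta_derivatives U phi z : open U -> smooth U phi -> minimal_surface_eq U phi -> U z ->
  let a := dz (zeta phi) z in let b := dzbar (zeta phi) z in let t := zeta phi z in
  a = (Cconj t * Cconj t * b)%C /\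
  (Jac (zeta phi) z = 0 ->
   (dz (dz (ofR phi)) z * dzbar (dzbar (ofR phi)) z - (dzbar (dz (ofR phi)) z) ^ 2)%C = 0).
Proof.
  intros HU Hf HM Hz a b t.
  destruct (smoothC_dz U _ HU (zeta_smooth phi U HU Hf)) as [Dzeta _]. specialize (Dzeta z Hz). fold a b in Dzeta.
  assert (Hp : smoothC U (ofR phi)) by (intros n; apply Ck_CkC; auto).
  destruct (smoothC_dz U _ HU Hp) as [_ [Hv Hu]].
  destruct (smoothC_dz U _ HU Hv) as [Dv _]. specialize (Dv z Hz).
  destruct (minimal_surface_wirtinger U phi z HU Hf HM Hz) as [Hm HE].
  set (k := dz (dz (ofR phi)) z) in *. set (m := dzbar (dz (ofR phi)) z) in *.
  destruct (zeta_mod phi z) as [r [Hr [Er Eu]]]. fold t in Er, Eu.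
  set (D := (1 - t * Cconj t)%C) in *.
  assert (D0 : D <> 0). { rewrite Er. intros E. apply RtoC_inj in E. lra. }
  assert (Dc : Cconj D = D). { rewrite Er. apply Cconj_RtoC. }
  assert (Du : rdiff (dzbar (ofR phi)) z m (Cconj k)).
  { rewrite <- Hm. apply (rdiff_ext (fun w => Cconj (dz (ofR phi) w))). apply filter_forall. intros w. symmetry. apply dzbar_ofR.
    apply rdiff_conj. exact Dv. }
  assert (DD : rdiff (fun w => 1 + -1 * (zeta phi w * Cconj (zeta phi w)))%C z
     (-1 * (a * Cconj t + t * Cconj b)) (-1 * (b * Cconj t + t * Cconj a))).
  { eapply rdiff_eq. apply rdiff_plus. apply rdiff_const. apply rdiff_scal. apply rdiff_mult. exact Dzeta.
    apply rdiff_conj. exact Dzeta. cbv beta; fold t; ring. cbv beta; fold t; ring. }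
  assert (ED : (1 + -1 * (t * Cconj t))%C = D) by (unfold D; ring).
  assert (DI : rdiff (fun w => / (1 + -1 * (zeta phi w * Cconj (zeta phi w))))%C z
     ((/ D * / D) * (a * Cconj t + t * Cconj b)) ((/ D * / D) * (b * Cconj t + t * Cconj a))).
  { eapply rdiff_eq. eapply (rdiff_comp _ Cinv); [exact DD | apply rdiff_Cinv; fold t; rewrite ED; exact D0].
    all: cbv beta; fold t; rewrite ED; ring. }
  assert (Du' := rdiff_mult _ _ _ _ _ _ _ Dzeta DI). cbv beta in Du'. fold t in Du'. rewrite ED in Du'.
  assert (Du2 : rdiff (dzbar (ofR phi)) z (a * / D + t * (/ D * / D * (a * Cconj t + t * Cconj b)))
        (b * / D + t * (/ D * / D * (b * Cconj t + t * Cconj a)))).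
  { eapply rdiff_ext. 2: exact Du'. apply filter_forall. intros w.
    destruct (zeta_mod phi w) as [_ [_ [_ Ew]]]. rewrite Ew. f_equal. f_equal. ring. }
  destruct (rdiff_unique _ _ _ _ _ _ Du Du2) as [Em Ek].
  assert (Em' : (m * (D * D) = a + t * t * Cconj b)%C).
  { rewrite Em. transitivity (a * D + t * (a * Cconj t + t * Cconj b))%C. field; auto. unfold D. ring. }
  assert (Ek' : (Cconj k * (D * D) = b + t * t * Cconj a)%C).
  { rewrite Ek. transitivity (b * D + t * (b * Cconj t + t * Cconj a))%C. field; auto. unfold D. ring. }
  assert (Em2 : (m * (D * D) = Cconj a + Cconj t * Cconj t * b)%C).
  { assert (Q := f_equal Cconj Em'). rewrite !Cplus_conj, !Cmult_conj, Cconj_conj, Dc, Hm in Q. exact Q. }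
  assert (Ek2 : (k * (D * D) = Cconj b + Cconj t * Cconj t * a)%C).
  { assert (Q := f_equal Cconj Ek'). rewrite !Cplus_conj, !Cmult_conj, !Cconj_conj, Dc in Q. exact Q. }
  assert (Ev : dz (ofR phi) z = (Cconj t * / D)%C).
  { rewrite <- (Cconj_conj (dz (ofR phi) z)), <- dzbar_ofR, Eu, Cmult_conj, Cinv_conj, Dc by auto. reflexivity. }
  set (Z := (t * Cconj t)%C).
  assert (Z1 : (1 + Z)%C <> 0).
  { unfold D in Er. fold Z in Er. replace Z with (1 - RtoC r)%C by (rewrite <- Er; ring).
    assert (P : 0 <= Re Z). { unfold Z, Re; simpl. nra. }
    replace Z with (1 - RtoC r)%C in P by (rewrite <- Er; ring). simpl in P.
    rewrite <- RtoC_minus, <- RtoC_plus. intros E. apply RtoC_inj in E. lra. }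
  split.
  - assert (HE' : ((1 + Z * Z) * (m * (D * D)) = t * t * (k * (D * D)) + Cconj t * Cconj t * (Cconj k * (D * D)))%C).
    { transitivity ((D * D) * (D * D) * ((1 + 2 * dzbar (ofR phi) z * dz (ofR phi) z) * m))%C.
      - rewrite Eu, Ev.
        transitivity ((D * D + 2 * (t * Cconj t)) * m * (D * D))%C.
        unfold D, Z. ring. field. auto.
      - rewrite HE, Eu, Ev. field. auto. }
    rewrite Ek', Ek2 in HE'.
    set (A := (a - Cconj t * Cconj t * b)%C).
    assert (A1 : (A * (D * (1 + Z)) = 0)%C).
    { assert (Q2 : ((1 + Z * Z) * (a + t * t * Cconj b + (Cconj a + Cconj t * Cconj t * b)) =
         2 * (t * t * (Cconj b + Cconj t * Cconj t * a) + Cconj t * Cconj t * (b + t * t * Cconj a)))%C).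
      { rewrite <- HE', <- Em'. rewrite <- Em2 at 1. ring. }
      assert (Q3 : (a + t * t * Cconj b = Cconj a + Cconj t * Cconj t * b)%C) by congruence.
      transitivity ((A - (a + t * t * Cconj b - (Cconj a + Cconj t * Cconj t * b)) / 2) * (D * (1 + Z)))%C.
      { rewrite Q3. field. }
      transitivity (((1 + Z * Z) * (a + t * t * Cconj b + (Cconj a + Cconj t * Cconj t * b)) -
         2 * (t * t * (Cconj b + Cconj t * Cconj t * a) + Cconj t * Cconj t * (b + t * t * Cconj a))) / 2)%C.
      { unfold A, D, Z. field. }
      rewrite Q2. field. }
    assert (A0 : A = 0).
    { apply Cmult_eq_reg_r with (D * (1 + Z))%C. rewrite A1. ring. apply Cmult_neq_0; auto. }
    replace a with (A + Cconj t * Cconj t * b)%C by (unfold A; ring). rewrite A0. ring.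
  - intros J0. assert (Edd : dzbar (dzbar (ofR phi)) z = Cconj k) by apply (rdiff_dz _ _ _ _ Du).
    rewrite Edd.
    apply Cmult_eq_reg_r with ((D * D) * (D * D))%C. 2: repeat apply Cmult_neq_0; auto.
    transitivity ((k * (D * D)) * (Cconj k * (D * D)) - (m * (D * D)) * (m * (D * D)))%C. simpl. ring.
    rewrite Ek2, Ek', Em2 at 1. rewrite Em2. rewrite <- Em2 at 1. rewrite Em'.
    transitivity (- ((1 - Z * Z) * Jac (zeta phi) z))%C. unfold Jac, Z. fold a b. ring.
    rewrite J0. ring.
Qed.

(** * Path integrals and derivatives *)

(** Tags chosen by the mean value theorem make every Riemann sum of [h] telescope to
    [H b - H a]; integrability of [h] thus replaces its continuity. *)
Lemma is_RInt_derivative (H h : R -> R) a b I : a < b ->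
  (forall x, a <= x <= b -> is_derive H x (h x)) -> is_RInt h a b I -> I = H b - H a.
Proof.
  intros Hab HD HI.
  (* The clause on [x <= y] alone makes [tag] an admissible choice of tags outside [a, b] too. *)
  set (good := fun x y c => (x <= y -> x <= c <= y) /\
     (a <= x -> x <= y -> y <= b -> H y - H x = h c * (y - x))).
  set (tag := fun x y => epsilon (inhabits 0) (good x y)).
  assert (Htag : forall x y, good x y (tag x y)).
  { intros x y. apply epsilon_spec. unfold good.
    destruct (Rle_dec a x) as [H1|H1], (Rle_dec x y) as [H2|H2], (Rle_dec y b) as [H3|H3];
      try (exists x; split; intros; lra).
    destruct (MVT_gen H x y h) as [c [Hc E]].
    - intros t. rewrite Rmin_left, Rmax_right by lra. intros Ht. apply HD. lra.
    - intros t. rewrite Rmin_left, Rmax_right by lra. intros Ht.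
      apply continuity_pt_filterlim. apply (ex_derive_continuous (K := R_AbsRing) (V := R_NormedModule)).
      eexists. apply HD. lra.
    - rewrite Rmin_left, Rmax_right in Hc by lra. exists c. split; auto. }
  assert (Last : forall P x, sorted Rle (x :: P)%list -> x <= seq.last x P).
  { induction P as [|y P IH]; intros x Hs. apply Rle_refl.
    destruct Hs as [Hxy Hs]. apply Rle_trans with (1 := Hxy). exact (IH y Hs). }
  assert (Tel : forall P x, sorted Rle (x :: P)%list -> a <= x -> seq.last x P <= b ->
    Riemann_sum h (SF_seq_f2 tag (x :: P)%list) = H (seq.last x P) - H x).
  { induction P as [|y P IH]; intros x Hs Hx Hb.
    - unfold Riemann_sum; simpl. unfold zero; simpl. ring.
    - rewrite SF_cons_f2 by (simpl; lia). rewrite Riemann_sum_cons.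
      destruct Hs as [Hxy Hs]. simpl in Hxy, Hb.
      rewrite IH; auto. 2: lra.
      simpl. unfold plus, scal; simpl. unfold mult; simpl.
      destruct (Htag x y) as [_ E].
      specialize (E Hx Hxy (Rle_trans _ _ _ (Last P y Hs) Hb)). lra. }
  apply Rminus_diag_uniq.
  destruct (Req_dec (I - (H b - H a)) 0) as [E0|E0]; [exact E0|exfalso].
  assert (He : 0 < Rabs (I - (H b - H a))) by (apply Rabs_pos_lt; exact E0).
  set (eps := Rabs (I - (H b - H a))) in *.
  destruct (HI (fun y => Rabs (y - I) < eps)) as [d Hd].
  { exists (mkposreal eps He). intros y Hy. exact Hy. }
  destruct (nfloor_ex ((b - a) / d)) as [n [_ Hn]].
  { apply Rlt_le, Rdiv_lt_0_compat. lra. apply cond_pos. }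
  destruct (Riemann_fine_unif_part tag a b n) as [S1 [S2 [S3 S4]]].
  { intros x y Hxy. apply (Htag x y). exact Hxy. } { lra. }
  assert (Hn0 : 0 < INR n + 1) by (generalize (pos_INR n); lra).
  assert (Hd0 := cond_pos d).
  assert (St : seq_step (SF_lx (SF_seq_f2 tag (unif_part a b n))) < d).
  { eapply Rle_lt_trans. exact S1. apply Rlt_div_l. lra.
    apply Rlt_div_l in Hn. lra. lra. }
  assert (Q := Hd (SF_seq_f2 tag (unif_part a b n)) St).
  rewrite Rmin_left, Rmax_right in Q by lra.
  specialize (Q (conj S2 (conj S3 S4))). cbv beta in Q.
  rewrite sign_eq_1 in Q by lra.
  assert (Hh := head_unif_part 0 a b n). assert (Hl := last_unif_part a a b n).
  assert (Hso := unif_part_sort a b n (Rlt_le _ _ Hab)).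
  clear S1 S2 S3 S4 St. revert Q Hh Hl Hso. generalize (unif_part a b n). intros [|x P] Q Hh Hl Hso. { simpl in Hl. lra. }
  simpl in Hh, Hl. subst x.
  assert (T := Tel P a Hso (Rle_refl _)). rewrite Hl in T. specialize (T (Rle_refl _)).
  assert (Q2 : Rabs (1 * (H b - H a) - I) < eps) by (rewrite <- T; exact Q).
  unfold eps in Q2. rewrite Rabs_minus_sym, Rmult_1_l in Q2. lra.
Qed.

Definition path_cont (g : R -> C) (t : R) : Prop :=
  continuous (T := R_UniformSpace) (U := C_R_NormedModule) g t.

Lemma path_cont_Re g t : path_cont g t -> continuous (fun s => Re (g s)) t.
Proof. intros H. apply (continuous_comp g Re). exact H. apply continuous_Re_C. Qed.
Lemma path_cont_Im g t : path_cont g t -> continuous (fun s => Im (g s)) t.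
Proof. intros H. apply (continuous_comp g Im). exact H. apply continuous_Im_C. Qed.

Lemma path_cont_pair (x y : R -> R) t : continuous x t -> continuous y t -> path_cont (fun s => (x s, y s)) t.
Proof.
  intros Hx Hy. apply (continuous_comp_2 (X := C_R_NormedModule) x y (fun a b => (a, b)) t Hx Hy).
  apply (continuous_ext (fun w => w)). intros [u v]; reflexivity. apply continuous_id.
Qed.

Lemma path_cont_mult F G t : path_cont F t -> path_cont G t -> path_cont (fun s => F s * G s)%C t.
Proof.
  intros HF HG. assert (F1 := path_cont_Re _ _ HF). assert (F2 := path_cont_Im _ _ HF).
  assert (G1 := path_cont_Re _ _ HG). assert (G2 := path_cont_Im _ _ HG).
  apply (path_cont_pair (fun s => Re (F s) * Re (G s) - Im (F s) * Im (G s))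
    (fun s => Re (F s) * Im (G s) + Im (F s) * Re (G s))).
  - apply (continuous_minus (V := R_NormedModule)); apply (continuous_mult (K := R_AbsRing)); auto.
  - apply (continuous_plus (V := R_NormedModule)); apply (continuous_mult (K := R_AbsRing)); auto.
Qed.

Lemma path_cont_comp f g t : path_cont g t -> ccont f (g t) -> path_cont (fun s => f (g s)) t.
Proof. intros Hg Hf. apply (continuous_comp g f). exact Hg. apply ccont_continuous. exact Hf. Qed.

Lemma is_derive_path_cont g t d :
  is_derive (K := R_AbsRing) (V := C_R_NormedModule) g t d -> path_cont g t.
Proof. intros H. apply (ex_derive_continuous (K := R_AbsRing) (V := C_R_NormedModule)). now exists d. Qed.

(** The integrand along a path is the derivative of [J] composed with the path. *)
Lemma primitive_CInt (D : C -> Prop) f J a b :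
  (forall w, D w -> rdiff J w (f w) 0) -> (forall w, D w -> ccont f w) ->
  is_CInt D f a b (J b - J a)%C.
Proof.
  intros HJ Hf g dg [H0 [H1 Hg]].
  assert (R := is_RInt_derive (V := C_R_CompleteNormedModule) (fun t => J (g t)) (fun t => f (g t) * dg t)%C 0 1).
  cbv beta in R. rewrite H0, H1 in R. apply R; intros t; rewrite Rmin_left, Rmax_right by lra; intros Ht;
    destruct (Hg t Ht) as [G1 [G2 G3]].
  - assert (E := rdiff_along J g t _ _ _ G2 (HJ _ G1)).
    replace (f (g t) * dg t)%C with (f (g t) * dg t + 0 * Cconj (dg t))%C by ring. exact E.
  - apply path_cont_mult. apply path_cont_comp. exact (is_derive_path_cont _ _ _ G2). auto. exact G3.
Qed.

(** The derivative of a holomorphic function is not known to be continuous here, so an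
    integral with integrand [q F' dg] cannot be differentiated directly. It equals the
    increment of [q F] minus an integral whose integrand [q' F dg] is continuous. *)
Lemma path_integral_derivative (D : C -> Prop) (q q' F F' : C -> C) (g dg : R -> C) (X : R -> R) :
  (forall w, rdiff q w (q' w) 0) -> (forall w, ccont q' w) ->
  (forall w, D w -> rdiff F w (F' w) 0) ->
  (forall t, 0 <= t <= 2 -> D (g t) /\
     is_derive (K := R_AbsRing) (V := C_R_NormedModule) g t (dg t) /\ path_cont dg t) ->
  (forall s, 0 < s < 2 -> exists I, Re I = X s /\
     is_RInt (V := C_R_NormedModule)
       (fun t => q (g (s * t)%R) * F' (g (s * t)%R) * (RtoC s * dg (s * t)%R))%C 0 1 I) ->
  is_derive X 1 (Re (q (g 1) * F' (g 1) * dg 1)%C).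
Proof.
  intros Hq Hq' HF Hg HI.
  set (h1 := fun t => Re (q (g t) * F' (g t) * dg t)%C).
  set (r := fun t => Re (q' (g t) * dg t * F (g t))%C).
  set (H := fun t => Re (q (g t) * F (g t))%C).
  assert (DH : forall t, 0 <= t <= 2 -> is_derive H t (h1 t + r t)).
  { intros t Ht. destruct (Hg t Ht) as [G1 [G2 G3]].
    assert (E := rdiff_along _ g t _ _ _ G2 (rdiff_mult _ _ _ _ _ _ _ (Hq (g t)) (HF _ G1))).
    apply is_derive_Re in E.
    replace (h1 t + r t) with (Re ((q' (g t) * F (g t) + q (g t) * F' (g t)) * dg t +
       (0 * F (g t) + q (g t) * 0) * Cconj (dg t))%C). exact E.
    unfold h1, r. simpl. ring. }
  assert (Cr : forall t, 0 <= t <= 2 -> continuous r t).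
  { intros t Ht. destruct (Hg t Ht) as [G1 [G2 G3]]. apply path_cont_Re.
    assert (Gc := is_derive_path_cont _ _ _ G2).
    repeat apply path_cont_mult; auto; apply path_cont_comp; auto. exact (rdiff_ccont _ _ _ _ (HF _ G1)). }
  assert (Ir : forall s, 0 <= s <= 2 -> is_RInt r 0 s (RInt r 0 s)).
  { intros s Hs. apply (RInt_correct (V := R_CompleteNormedModule)).
    apply (ex_RInt_continuous (V := R_CompleteNormedModule)).
    intros t. rewrite Rmin_left, Rmax_right by lra. intros Ht. apply Cr. lra. }
  assert (EX : forall s, 0 < s < 2 -> X s = H s - H 0 - RInt r 0 s).
  { intros s Hs. destruct (HI s Hs) as [I [E1 E2]].
    assert (I1 : is_RInt h1 0 s (X s)).
    { rewrite <- E1. apply (is_RInt_ext (V := R_NormedModule) (fun t => Re (q (g t) * F' (g t) * dg t)%C)). reflexivity.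
      apply (is_RInt_fct_extend_fst (U := R_NormedModule) (V := R_NormedModule) (fun t => q (g t) * F' (g t) * dg t)%C).
      eapply (is_RInt_ext (V := C_R_NormedModule)).
      2:{ apply (is_RInt_comp_lin (V := C_R_NormedModule) (fun t => q (g (s * t)%R) * F' (g (s * t)%R) * (RtoC s * dg (s * t)%R))%C (/ s) 0 0 s I).
          replace (/ s * 0 + 0) with 0 by ring. replace (/ s * s + 0) with 1 by (field; lra).
          exact E2. }
      intros t _. cbv beta. replace (s * (/ s * t + 0)) with t by (field; lra).
      assert (Es : forall (k : R) (w : C), scal (V := C_R_NormedModule) k w = (RtoC k * w)%C).
      { intros k w. apply injective_projections; unfold scal; simpl; unfold scal; simpl; unfold mult; simpl; ring. }
      rewrite Es. rewrite RtoC_inv by lra. match goal with |- @eq _ ?a ?b => change (@eq C a b) end. field. intros E. apply RtoC_inj in E. lra. }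
    assert (Q := is_RInt_derivative H (fun t => h1 t + r t) 0 s (X s + RInt r 0 s)).
    rewrite <- Q. ring. lra. intros t Ht; apply DH; lra.
    apply (is_RInt_plus (V := R_NormedModule)); auto. apply Ir. lra. }
  apply (is_derive_ext_loc (fun s => H s - H 0 - RInt r 0 s)).
  { exists (mkposreal 1 Rlt_0_1). intros s Hs. unfold ball in Hs; simpl in Hs. unfold AbsRing_ball, abs, minus, plus, opp in Hs; simpl in Hs.
    apply Rabs_def2 in Hs. symmetry. apply EX. lra. }
  assert (Dr : is_derive (fun s => RInt r 0 s) 1 (r 1)).
  { apply (is_derive_RInt (V := R_NormedModule) r _ 0 1).
    - exists (mkposreal 1 Rlt_0_1). intros s Hs. unfold ball in Hs; simpl in Hs. unfold AbsRing_ball, abs, minus, plus, opp in Hs; simpl in Hs.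
      apply Rabs_def2 in Hs. apply Ir. lra.
    - apply Cr. lra. }
  replace (Re (q (g 1%R) * F' (g 1%R) * dg 1%R)%C) with ((h1 1 + r 1) - 0 - r 1) by (unfold h1; ring).
  apply (is_derive_minus (V := R_NormedModule)); auto.
  apply (is_derive_minus (V := R_NormedModule)). apply DH; lra. apply (is_derive_const (V := R_NormedModule)).
Qed.

(** * Primitives, and charts of a minimal graph *)

Lemma Cmod_le_box (x1 y1 x2 y2 : R) : Rabs x1 <= Rabs x2 -> Rabs y1 <= Rabs y2 ->
  Cmod (x1, y1) <= Cmod (x2, y2).
Proof.
  intros Hx Hy. unfold Cmod; simpl. apply sqrt_le_1_alt. rewrite !Rmult_1_r.
  apply Rplus_le_compat; apply Rsqr_le_abs_1; assumption.
Qed.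

Lemma between_abs (t a b : R) : Rmin a b <= t <= Rmax a b -> Rabs (t - a) <= Rabs (b - a).
Proof.
  intros H. destruct (Rle_dec a b).
  - rewrite Rmin_left, Rmax_right in H by lra. rewrite !Rabs_pos_eq by lra. lra.
  - rewrite Rmin_right, Rmax_left in H by lra. rewrite !Rabs_left1 by lra. lra.
Qed.

(** Poincare's lemma: the closed form [p dx + q dy] is integrated along a horizontal
    segment followed by a vertical one; both stay in the disc when they start at its
    centre. The hypothesis with [m] says that the form is closed. *)
Lemma closed_form_potential (c : C) (r : R) (p q m : C -> R) :
  (forall w, Cdisc c r w -> continuous p w /\ continuous q w /\ continuous m w /\
     is_derive (fun t => p (Re w, t)) (Im w) (m w) /\
     is_derive (fun t => q (t, Im w)) (Re w) (m w)) ->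
  exists T : C -> R, forall w, Cdisc c r w ->
    is_derive (fun t => T (t, Im w)) (Re w) (p w) /\
    is_derive (fun t => T (Re w, t)) (Im w) (q w).
Proof.
  intros H. destruct c as [x0 y0].
  set (D := fun x y => Cdisc (x0, y0) r (x, y)).
  assert (Dsub : forall x y x' y', D x y -> Rabs (x' - x0) <= Rabs (x - x0) ->
    Rabs (y' - y0) <= Rabs (y - y0) -> D x' y').
  { intros x y x' y' HD Hx Hy. unfold D, Cdisc in *.
    eapply Rle_lt_trans. 2: exact HD. apply (Cmod_le_box (x' + - x0) (y' + - y0) (x + - x0) (y + - y0)); assumption. }
  assert (Dx' : forall x y, D x y -> locally x (fun x' => D x' y)).
  { intros x y HD. destruct (Cdisc_open _ _ _ HD) as [d Hd]. exists d. intros x' Hx'. apply Hd.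
    split. exact Hx'. apply ball_center. }
  assert (Dy' : forall x y, D x y -> locally y (fun y' => D x y')).
  { intros x y HD. destruct (Cdisc_open _ _ _ HD) as [d Hd]. exists d. intros y' Hy'. apply Hd.
    split. apply ball_center. exact Hy'. }
  assert (Z0 : forall x y : R, Rabs (y - y) <= Rabs (x - y)).
  { intros x y. replace (y - y) with 0 by ring. rewrite Rabs_R0. apply Rabs_pos. }
  assert (cont1 : forall (f : C -> R) x y, continuous f (x, y) -> continuous (fun t => f (t, y)) x).
  { intros f x y Hf. apply (continuous_comp (fun t => (t, y) : C) f). 2: exact Hf.
    apply path_cont_pair. apply continuous_id. apply continuous_const. }
  assert (cont2 : forall (f : C -> R) x y, continuous f (x, y) -> continuous (fun t => f (x, t)) y).
  { intros f x y Hf. apply (continuous_comp (fun t => (x, t) : C) f). 2: exact Hf.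
    apply path_cont_pair. apply continuous_const. apply continuous_id. }
  assert (I1 : forall x y, D x y -> is_RInt (fun t => p (t, y0)) x0 x (RInt (fun t => p (t, y0)) x0 x)).
  { intros x y HD. apply (RInt_correct (V := R_CompleteNormedModule)).
    apply (ex_RInt_continuous (V := R_CompleteNormedModule)). intros t Ht.
    apply cont1. apply H. apply (Dsub x y); auto. apply between_abs; auto. }
  assert (I2 : forall (f : C -> R) x y, D x y -> (forall x y, D x y -> continuous f (x, y)) ->
     is_RInt (fun t => f (x, t)) y0 y (RInt (fun t => f (x, t)) y0 y)).
  { intros f x y HD Hf. apply (RInt_correct (V := R_CompleteNormedModule)).
    apply (ex_RInt_continuous (V := R_CompleteNormedModule)). intros t Ht.
    apply cont2. apply Hf. apply (Dsub x y); auto. lra. apply between_abs; auto. }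
  exists (fun w => RInt (fun t => p (t, y0)) x0 (Re w) + RInt (fun t => q (Re w, t)) y0 (Im w)).
  intros [x y] HD. simpl. split.
  - replace (p (x, y)) with (p (x, y0) + (p (x, y) - p (x, y0))) by ring.
    apply (is_derive_plus (V := R_NormedModule)).
    + apply (is_derive_RInt (V := R_NormedModule) (fun t => p (t, y0)) _ x0 x).
      * generalize (Dx' x y HD). apply filter_imp. intros x' HD'. apply (I1 x' y HD').
      * apply cont1. apply H. apply (Dsub x y); auto. lra.
    + assert (Em : forall x y, D x y -> Derive (fun u => q (u, y)) x = m (x, y)).
      { intros u v HD'. apply is_derive_unique. apply (H _ HD'). }
      assert (E : RInt (fun t => Derive (fun u => q (u, t)) x) y0 y = p (x, y) - p (x, y0)).
      { apply is_RInt_unique. apply (is_RInt_ext (V := R_NormedModule) (fun t => m (x, t))).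
        - intros t Ht. symmetry. apply Em. apply (Dsub x y); auto. lra. apply between_abs. lra.
        - apply (is_RInt_derive (V := R_CompleteNormedModule) (fun t => p (x, t)) (fun t => m (x, t))); intros t Ht;
            (assert (HD' : D x t) by (apply (Dsub x y); auto; [lra | apply between_abs; lra])).
          + apply (H _ HD').
          + apply cont2. apply (H _ HD'). }
      rewrite <- E. apply (is_derive_RInt_param (fun x t => q (x, t)) y0 y x).
      * generalize (Dx' x y HD). apply filter_imp. intros x' HD' t Ht. exists (m (x', t)).
        apply (H (x', t)). apply (Dsub x' y); auto. lra. apply between_abs. lra.
      * intros t Ht. assert (HD' : D x t) by (apply (Dsub x y); auto; [lra | apply between_abs; lra]).
        apply (continuity_2d_pt_ext_loc (fun u v => m (u, v))).
        -- destruct (Cdisc_open _ _ _ HD') as [d Hd]. exists d. intros u v Hu Hv. symmetry. apply Em. apply Hd. split; assumption.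
        -- apply continuity_2d_pt_filterlim. apply (continuous_ext (T := C_UniformSpace) (U := R_UniformSpace) m (fun z => m (fst z, snd z))). intros [u v]; reflexivity. apply (H _ HD').
      * generalize (Dx' x y HD). apply filter_imp. intros x' HD'. eexists. apply (I2 q x' y HD').
        intros u v Huv. apply (H _ Huv).
  - replace (q (x, y)) with (0 + q (x, y)) by ring.
    apply (is_derive_plus (V := R_NormedModule)). apply (is_derive_const (V := R_NormedModule)).
    apply (is_derive_RInt (V := R_NormedModule) (fun t => q (x, t)) _ y0 y).
    + generalize (Dy' x y HD). apply filter_imp. intros y' HD'. apply (I2 q x y' HD').
      intros u v Huv. apply (H _ Huv).
    + apply cont2. apply (H _ HD).
Qed.

(** By the Cauchy-Riemann equations the real and imaginary parts of [f dz] are closed. *)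
Lemma holomorphic_primitive c r f f' :
  (forall w, Cdisc c r w -> rdiff f w (f' w) 0) -> (forall w, Cdisc c r w -> ccont f' w) ->
  exists J, forall w, Cdisc c r w -> rdiff J w (f w) 0.
Proof.
  intros Hf Hf'.
  assert (cRe : forall g (w : C), ccont g w -> continuous (T := C_UniformSpace) (fun z => Re (g z)) w).
  { intros g w Hg. apply (continuous_comp g Re). apply ccont_continuous. exact Hg. apply continuous_Re_C. }
  assert (cIm : forall g (w : C), ccont g w -> continuous (T := C_UniformSpace) (fun z => Im (g z)) w).
  { intros g w Hg. apply (continuous_comp g Im). apply ccont_continuous. exact Hg. apply continuous_Im_C. }
  assert (cf : forall w, Cdisc c r w -> ccont f w) by (intros w Hw; exact (rdiff_ccont _ _ _ _ (Hf w Hw))).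
  assert (fx : forall w, Cdisc c r w -> is_derive (K := R_AbsRing) (V := C_R_NormedModule) (fun t => f (t, Im w)) (Re w) (f' w)).
  { intros w Hw. assert (E := rdiff_x _ _ _ _ (Hf w Hw)). rewrite Cplus_0_r in E. exact E. }
  assert (fy : forall w, Cdisc c r w -> is_derive (K := R_AbsRing) (V := C_R_NormedModule) (fun t => f (Re w, t)) (Im w) (Ci * f' w)%C).
  { intros w Hw. assert (E := rdiff_y _ _ _ _ (Hf w Hw)). replace (f' w - 0)%C with (f' w) in E by ring. exact E. }
  destruct (closed_form_potential c r (fun w => Re (f w)) (fun w => - Im (f w)) (fun w => - Im (f' w))) as [T1 HT1].
  { intros w Hw. split; [|split; [|split; [|split]]].
    - apply cRe; auto.
    - apply (continuous_opp (V := R_NormedModule)). apply cIm; auto.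
    - apply (continuous_opp (V := R_NormedModule)). apply cIm; auto.
    - replace (- Im (f' w)) with (Re (Ci * f' w)%C) by (simpl; unfold Im; ring). exact (is_derive_Re _ _ _ (fy w Hw)).
    - apply (is_derive_opp (V := R_NormedModule)). exact (is_derive_Im _ _ _ (fx w Hw)). }
  destruct (closed_form_potential c r (fun w => Im (f w)) (fun w => Re (f w)) (fun w => Re (f' w))) as [T2 HT2].
  { intros w Hw. split; [|split; [|split; [|split]]].
    - apply cIm; auto.
    - apply cRe; auto.
    - apply cRe; auto.
    - replace (Re (f' w)) with (Im (Ci * f' w)%C) by (simpl; unfold Re; ring). exact (is_derive_Im _ _ _ (fy w Hw)).
    - exact (is_derive_Re _ _ _ (fx w Hw)). }
  exists (fun w => ofR T1 w + Ci * ofR T2 w)%C. intros w Hw.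
  assert (Nw := open_near _ _ (Cdisc_open c r) Hw).
  assert (R1 := rdiff_of_partials T1 w (fun w => Re (f w)) (fun w => - Im (f w))
    (near_imp _ _ _ (fun v Hv => proj1 (HT1 v Hv)) Nw) (proj2 (HT1 w Hw)) (cRe f w (cf w Hw))).
  assert (R2 := rdiff_of_partials T2 w (fun w => Im (f w)) (fun w => Re (f w))
    (near_imp _ _ _ (fun v Hv => proj1 (HT2 v Hv)) Nw) (proj2 (HT2 w Hw)) (cIm f w (cf w Hw))).
  eapply rdiff_eq. exact (rdiff_plus _ _ _ _ _ _ _ R1 (rdiff_scal Ci _ _ _ _ R2)).
  - apply injective_projections; simpl; unfold Re, Im; field.
  - apply injective_projections; simpl; unfold Re, Im; field.
Qed.

Lemma rdiff_Re f z a b : rdiff f z a b ->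
  rdiff (ofR (fun w => Re (f w))) z ((a + Cconj b) / 2) ((b + Cconj a) / 2).
Proof.
  intros H. eapply rdiff_eq. eapply rdiff_ext.
  2: exact (rdiff_scal (/2) _ _ _ _ (rdiff_plus _ _ _ _ _ _ _ H (rdiff_conj _ _ _ _ H))).
  apply filter_forall. intros w. apply injective_projections; unfold ofR, Re, Im; simpl; field.
  field. field.
Qed.

Lemma rdiff_Im f z a b : rdiff f z a b ->
  rdiff (ofR (fun w => Im (f w))) z ((a - Cconj b) / (2 * Ci)) ((b - Cconj a) / (2 * Ci)).
Proof.
  assert (Ci0 : Ci <> 0) by (intros E; apply (f_equal snd) in E; simpl in E; lra).
  intros H. eapply rdiff_eq. eapply rdiff_ext.
  2: exact (rdiff_scal (/(2 * Ci)) _ _ _ _ (rdiff_plus _ _ _ _ _ _ _ H (rdiff_scal (-1) _ _ _ _ (rdiff_conj _ _ _ _ H)))).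
  apply filter_forall. intros w. apply injective_projections; unfold ofR, Re, Im; simpl; field.
  field; auto. field; auto.
Qed.

Lemma Ci_sqr : (Ci * Ci)%C = (-1)%C.
Proof. apply injective_projections; simpl; ring. Qed.

(** With [beta = Cconj psi_wbar] the hypothesis reads [psi_w = - zeta^2 beta]. Then
    [x_w ^ 2 + y_w ^ 2 = psi_w beta = - zeta^2 beta^2], while
    [phi_w = v psi_w + u beta = (u - v zeta^2) beta = zeta beta]. *)
Lemma conformal_parametrization U phi psi w a b : open U -> smooth U phi -> U (psi w) ->
  rdiff psi w a b -> a = (- (zeta phi (psi w) * zeta phi (psi w) * Cconj b))%C ->
  dz (ofR (fun s => phi (psi s))) w = (zeta phi (psi w) * Cconj b)%C /\
  (dz (ofR (fun s => Re (psi s))) w ^ 2 + dz (ofR (fun s => Im (psi s))) w ^ 2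
      + dz (ofR (fun s => phi (psi s))) w ^ 2)%C = RtoC 0.
Proof.
  intros HU Hf Hw Hpsi Ea.
  assert (Ci0 : Ci <> 0) by (intros E; apply (f_equal snd) in E; simpl in E; lra).
  assert (Hp : smoothC U (ofR phi)) by (intros n; apply Ck_CkC; auto).
  destruct (smoothC_dz U _ HU Hp) as [D _].
  assert (Dphi := rdiff_comp psi (ofR phi) w _ _ _ _ Hpsi (D _ Hw)).
  change (fun w => ofR phi (psi w)) with (ofR (fun s => phi (psi s))) in Dphi.
  assert (E3 : dz (ofR (fun s => phi (psi s))) w = (zeta phi (psi w) * Cconj b)%C).
  { rewrite (proj1 (rdiff_dz _ _ _ _ Dphi)).
    destruct (zeta_mod phi (psi w)) as [r [Hr [Er Eu]]].
    set (t := zeta phi (psi w)) in *.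
    rewrite <- (Cconj_conj (dz (ofR phi) (psi w))), <- dzbar_ofR, Eu, Ea.
    assert (D0 : (1 - t * Cconj t)%C <> 0). { rewrite Er. intros E. apply RtoC_inj in E. lra. }
    rewrite Cmult_conj, Cinv_conj by auto.
    replace (Cconj (1 - t * Cconj t)) with (1 - t * Cconj t)%C.
    2:{ rewrite Er, Cconj_RtoC. reflexivity. }
    field. auto. }
  split; auto. rewrite E3.
  rewrite (proj1 (rdiff_dz _ _ _ _ (rdiff_Re _ _ _ _ Hpsi))), (proj1 (rdiff_dz _ _ _ _ (rdiff_Im _ _ _ _ Hpsi))).
  set (t := zeta phi (psi w)) in *. rewrite Ea. generalize (Cconj b). intros B. simpl.
  transitivity ((((- (t * t * B) + B) * (- (t * t * B) + B)) / 4 + ((- (t * t * B) - B) * (- (t * t * B) - B)) / (4 * (Ci * Ci)) + t * t * B * B)%C).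
  field. auto. rewrite Ci_sqr. field.
Qed.

(** By the inverse function theorem, the relation [chi_z = Cconj zeta ^ 2 chi_zbar] becomes
    [psi_w = - zeta^2 Cconj psi_wbar] for the inverse [psi] of [chi], and
    [conformal_parametrization] applies. Both [zeta] and [rho] satisfy this relation. *)
Lemma surface_coordinate U phi chi p : open U -> smooth U phi -> U p -> smoothC U chi ->
  (forall z, U z -> dz chi z = (Cconj (zeta phi z) * Cconj (zeta phi z) * dzbar chi z)%C) ->
  Jac chi p <> 0 ->
  exists (N : C -> Prop) (eta : R) (psi : C -> C), let V := Cdisc (chi p) eta in
    0 < eta /\ N p /\ (forall z, N z -> U z) /\ complex_coordinate phi N chi V psi /\
    smoothC V psi /\
    (forall w, V w -> Jac chi (psi w) <> 0 /\ let b := dzbar psi w in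
       b = (- dzbar chi (psi w) / Jac chi (psi w))%C /\
       rdiff psi w (- (zeta phi (psi w) * zeta phi (psi w) * Cconj b)) b /\
       dz (ofR (fun s => phi (psi s))) w = (zeta phi (psi w) * Cconj b)%C).
Proof.
  intros HU Hf Hp Hchi Hc HJ.
  destruct (inverse_function U chi p HU Hchi Hp HJ) as [N [eta [psi [He [HN [HNp [HNU [H1 [H2 [H3 H4]]]]]]]]]].
  set (V := Cdisc (chi p) eta) in *.
  assert (Q : forall w, V w -> Jac chi (psi w) <> 0 /\ let b := dzbar psi w in
       b = (- dzbar chi (psi w) / Jac chi (psi w))%C /\
       rdiff psi w (- (zeta phi (psi w) * zeta phi (psi w) * Cconj b)) b).
  { intros w Hw. destruct (H4 w Hw) as [J0 D]. split; auto. cbv zeta.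
    destruct (rdiff_dz _ _ _ _ D) as [_ E]. split; auto. rewrite E.
    eapply rdiff_eq. exact D. 2: reflexivity.
    rewrite (Hc _ (HNU _ (proj1 (H2 w Hw)))).
    rewrite Cdiv_conj, Copp_conj, Jac_real, !Cmult_conj, !Cconj_conj by auto. field. auto. }
  assert (P : forall w, V w -> let b := dzbar psi w in
    dz (ofR (fun s => phi (psi s))) w = (zeta phi (psi w) * Cconj b)%C /\
    (dz (ofR (fun s => Re (psi s))) w ^ 2 + dz (ofR (fun s => Im (psi s))) w ^ 2
      + dz (ofR (fun s => phi (psi s))) w ^ 2)%C = RtoC 0).
  { intros w Hw. destruct (Q w Hw) as [_ [_ D]].
    eapply (conformal_parametrization U phi psi w); eauto. apply HNU, H2, Hw. }
  exists N, eta, psi. cbv zeta. fold V. split; [exact He|]. split; [exact HNp|]. split; [exact HNU|]. split; [|split; [exact H3|]].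
  - split; [exact HN|]. split; [apply Cdisc_open|]. split; [exact H1|]. split; [exact H2|]. split; [|split].
    + apply Csmooth_smoothC; auto. intros n. apply (CkC_sub n U); auto.
    + apply Csmooth_smoothC; auto. apply Cdisc_open.
    + intros w Hw. apply (P w Hw).
  - intros w Hw. destruct (Q w Hw) as [A [B D]]. split; auto. split; auto. split; auto. apply (P w Hw).
Qed.

(** * Holomorphic functions and the Weierstrass formulas *)

Lemma rdiff_is_derive f w a : rdiff f w a 0 <->
  is_derive (K := C_AbsRing) (V := C_NormedModule) f w a.
Proof.
  assert (E : forall y, norm (minus (minus (f y : C_NormedModule) (f w)) (scal (minus (y : C_AbsRing) w) (a : C_NormedModule)))
    = Cmod (f y - f w - (a * (y - w) + 0 * Cconj (y - w)))).
  { intros y. change (Cmod (f y - f w - (y - w) * a) = Cmod (f y - f w - (a * (y - w) + 0 * Cconj (y - w)))).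
    f_equal. ring. }
  split.
  - intros H. split. apply is_linear_scal_l. intros x Hx.
    assert (Ex := is_filter_lim_locally_unique (K := C_AbsRing) (V := AbsRing_NormedModule C_AbsRing) w x Hx). subst x.
    intros eps. apply locally_C. generalize (H eps (cond_pos eps)). apply near_imp.
    intros y Hy. rewrite E. exact Hy.
  - intros [_ H] eps He. specialize (H w (fun P HP => HP) (mkposreal eps He)).
    apply locally_C in H. revert H. apply near_imp. intros y Hy. rewrite E in Hy. exact Hy.
Qed.

Lemma holomorphic_rdiff D f w : holomorphic_on D f -> D w -> rdiff f w (C_derive f w) 0.
Proof.
  intros H Hw. destruct (H w Hw) as [l Hl]. rewrite (is_C_derive_unique f w l Hl).
  apply rdiff_is_derive. exact Hl.
Qed.

Lemma rdiff_conj_conj f w a : rdiff f (Cconj w) a 0 ->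
  rdiff (fun s => Cconj (f (Cconj s))) w (Cconj a) 0.
Proof.
  intros H. eapply rdiff_eq.
  apply (rdiff_conj (fun s => f (Cconj s))). exact (rdiff_comp Cconj f w _ _ _ _ (rdiff_Cconj w) H).
  - rewrite Cplus_conj, !Cmult_conj, !Cconj_conj, !Cconj_RtoC. ring.
  - rewrite Cplus_conj, !Cmult_conj, !Cconj_conj, !Cconj_RtoC. ring.
Qed.

Lemma Cdisc_conj a r w : Cdisc (Cconj a) r w -> Cdisc a r (Cconj w).
Proof.
  unfold Cdisc. rewrite <- (Cmod_conj (Cconj w - a)), Cminus_conj, Cconj_conj. auto.
Qed.

(** Reflection of domain and range; it carries [F] and its inverse to [G] and the
    inverse of [G]. *)
Lemma local_inverse_conj f a r g r' : local_inverse f a r g r' ->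
  local_inverse (fun s => Cconj (f (Cconj s))) (Cconj a) r (fun s => Cconj (g (Cconj s))) r'.
Proof.
  intros [H1 [H2 [H3 H4]]].
  assert (Sub : forall s, Cdisc (Cconj (f (Cconj (Cconj a)))) r' s -> Cdisc (f a) r' (Cconj s)).
  { intros s Hs. rewrite Cconj_conj in Hs. apply Cdisc_conj. exact Hs. }
  split; [|split; [|split]].
  - intros s Hs. eexists. apply rdiff_is_derive. apply rdiff_conj_conj.
    exact (holomorphic_rdiff _ _ _ H1 (Sub s Hs)).
  - rewrite !Cconj_conj, H2. reflexivity.
  - intros s Hs. destruct (H3 _ (Sub s Hs)) as [A B]. split.
    + apply Cdisc_conj. rewrite Cconj_conj. exact A.
    + rewrite Cconj_conj, B, Cconj_conj. reflexivity.
  - apply (near_imp _ (fun s => g (f (Cconj s)) = Cconj s)).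
    + intros s Hs. rewrite Cconj_conj, Hs, Cconj_conj. reflexivity.
    + apply (ccont_near Cconj (Cconj a) (fun w => g (f w) = w)). apply ccont_Cconj.
      rewrite Cconj_conj. exact H4.
Qed.

Lemma Re_directions_zero (E : C) (k : R) : 0 < k ->
  (forall d, Cmod d < k -> Re (E * d)%C = 0) -> E = 0.
Proof.
  intros Hk H. assert (P : 0 < Cmod E + 1) by (generalize (Cmod_ge_0 E); lra).
  set (s := k / (Cmod E + 1)). assert (Hs : 0 < s) by (apply Rdiv_lt_0_compat; lra).
  assert (H0 := H (RtoC s * Cconj E)%C).
  rewrite Cmod_mult, Cmod_conj, Cmod_R, Rabs_pos_eq in H0 by lra.
  assert (Q : s * Cmod E < k).
  { replace k with (s * (Cmod E + 1)) by (unfold s; field; lra). apply Rmult_lt_compat_l; lra. }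
  specialize (H0 Q).
  assert (E2 : s * Cmod E ^ 2 = 0).
  { rewrite <- H0. rewrite Cmod2_alt. unfold Re, Im; simpl. ring. }
  apply Cmod_eq_0. destruct (Rmult_integral _ _ E2) as [E3|E3]. lra.
  simpl in E3. rewrite Rmult_1_r in E3. destruct (Rmult_integral _ _ E3); auto.
Qed.

(** Because [zeta] has modulus less than 1. *)
Lemma zeta_sqr_neq1 phi z : (1 - zeta phi z ^ 2)%C <> 0.
Proof.
  intros E. destruct (zeta_mod phi z) as [r [Hr [Er _]]].
  set (t := zeta phi z) in *.
  assert (E1 : (t ^ 2 = 1)%C). { replace (t ^ 2)%C with (1 - (1 - t ^ 2))%C by ring. rewrite E. ring. }
  assert (E2 : Cmod t ^ 2 = 1). { rewrite <- Cmod_pow, E1. apply Cmod_1. }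
  assert (E3 := Cmod2_conj t). rewrite <- E3, E2 in Er.
  rewrite <- RtoC_minus in Er. apply RtoC_inj in Er. lra.
Qed.

(** The formula for [x] is differentiated along paths that arrive at [w] with an arbitrary
    velocity [d]. On one side this gives [Re ((1 - w^2) F'(w) d)], on the other side
    [Re (psi_w d + psi_wbar Cconj d) = Re ((1 - w^2) Cconj psi_wbar d)]. Hence [F'] is the
    conjugate of [psi_wbar], since [1 - w^2] is nonzero by [zeta_sqr_neq1]. *)
Lemma weierstrass_density phi p W r F psi delta :
  let zeta0 := zeta phi p in
  delta <= r ->
  (forall w, Cdisc zeta0 delta w -> W (psi w) /\ zeta phi (psi w) = w /\
     rdiff psi w (- (w * w * Cconj (dzbar psi w))) (dzbar psi w)) ->
  holomorphic_on (Cdisc zeta0 r) F ->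
  (forall z, W z -> Cdisc zeta0 r (zeta phi z) -> weierstrass_at phi p r F z) ->
  forall w, Cdisc zeta0 delta w -> C_derive F w = Cconj (dzbar psi w).
Proof.
  intros zeta0 Hdr Hpsi HF HW w Hw.
  assert (Dsub : forall y, Cdisc zeta0 delta y -> Cdisc zeta0 r y) by (unfold Cdisc; intros; lra).
  set (b := dzbar psi w).
  set (e := (w - zeta0)%C). assert (He : Cmod e < delta) by exact Hw.
  set (E := ((1 - w ^ 2) * (C_derive F w - Cconj b))%C).
  assert (E0 : E = 0).
  { apply (Re_directions_zero E ((delta - Cmod e) / 2)). lra. intros d Hd.
    (* A parabola from [zeta0] that is at [w] at time 1 with velocity [d]; it stays in the
       disc up to time 2, so that time 1 is interior. *)
    set (g := fun t : R => (zeta0 + (e * RtoC t + (d - e) * (RtoC t * RtoC t - RtoC t)))%C).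
    set (dg := fun t : R => ((2 * e - d) + RtoC t * (2 * (d - e)))%C).
    assert (g0 : g 0 = zeta0) by (unfold g; ring).
    assert (g1 : g 1 = w) by (unfold g, e; ring).
    assert (dg1 : dg 1 = d) by (unfold dg; ring).
    assert (Dg : forall t, is_derive (K := R_AbsRing) (V := C_R_NormedModule) g t (dg t)).
    { intros t. set (c := fun s : R => (0 + RtoC s * 1)%C).
      assert (Dc : is_derive (K := R_AbsRing) (V := C_R_NormedModule) c t (RtoC 1)) by apply (is_derive_segment 0 1 t).
      assert (Dp : rdiff (fun x => zeta0 + (e * x + (d - e) * (x * x + -1 * x)))%C (c t) (e + (d - e) * (2 * c t + -1)) 0).
      { eapply rdiff_eq. apply rdiff_plus. apply rdiff_const. apply rdiff_plus. apply rdiff_scal, rdiff_id.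
        apply rdiff_scal. apply rdiff_plus. apply rdiff_sqr. apply rdiff_scal, rdiff_id. ring. ring. }
      assert (Q := rdiff_along _ _ _ _ _ _ Dc Dp).
      replace (dg t) with ((e + (d - e) * (2 * c t + -1)) * 1 + 0 * Cconj 1)%C.
      2:{ unfold dg, c. ring. }
      apply (is_derive_ext (K := R_AbsRing) (V := C_R_NormedModule) (fun s => zeta0 + (e * c s + (d - e) * (c s * c s + -1 * c s)))%C).
      { intros s. unfold g, c. change (@eq C (zeta0 + (e * (0 + RtoC s * 1) + (d - e) * ((0 + RtoC s * 1) * (0 + RtoC s * 1) + -1 * (0 + RtoC s * 1))))%C
          (zeta0 + (e * RtoC s + (d - e) * (RtoC s * RtoC s - RtoC s)))%C). ring. }
      exact Q. }
    assert (Cdg : forall t, path_cont dg t).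
    { intros t. exact (is_derive_path_cont _ _ _ (is_derive_segment (2 * e - d) (2 * (d - e)) t)). }
    assert (gD : forall t, 0 <= t <= 2 -> Cdisc zeta0 delta (g t)).
    { intros t Ht. unfold Cdisc, g.
      replace (zeta0 + (e * RtoC t + (d - e) * (RtoC t * RtoC t - RtoC t)) - zeta0)%C
        with (RtoC (2 * t - t * t) * e + RtoC (t * t - t) * d)%C.
      2:{ rewrite !RtoC_minus, !RtoC_mult. ring. }
      eapply Rle_lt_trans. apply Cmod_triangle. rewrite !Cmod_mult, !Cmod_R.
      assert (T1 : 0 <= t * (2 - t)) by (apply Rmult_le_pos; lra).
      assert (T2 := Rle_0_sqr (1 - t)). unfold Rsqr in T2.
      assert (Rabs (2 * t - t * t) <= 1) by (apply Rabs_le; lra).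
      assert (Rabs (t * t - t) <= 2) by (apply Rabs_le; lra).
      assert (B1 : Rabs (2 * t - t * t) * Cmod e <= 1 * Cmod e) by (apply Rmult_le_compat_r; [apply Cmod_ge_0 | auto]).
      assert (B2 : Rabs (t * t - t) * Cmod d <= 2 * Cmod d) by (apply Rmult_le_compat_r; [apply Cmod_ge_0 | auto]).
      lra. }
    assert (DX := path_integral_derivative (Cdisc zeta0 r) (fun x => 1 - x ^ 2)%C (fun x => -2 * x)%C
      F (C_derive F) g dg (fun s => Re (psi (g s)) - Re p)).
    assert (DX' : is_derive (fun s => Re (psi (g s)) - Re p) 1 (Re ((1 - w ^ 2) * C_derive F w * d)%C)).
    { rewrite <- g1, <- dg1. apply DX; clear DX.
      - intros x. eapply rdiff_ext. 2:{ eapply rdiff_eq. apply rdiff_plus. apply (rdiff_const 1).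
        apply (rdiff_scal (-1)). apply rdiff_sqr. ring. ring. }
        apply filter_forall. intros y. simpl. ring.
      - intros x. exact (rdiff_ccont _ _ _ _ (rdiff_scal (-2) _ _ _ _ (rdiff_id x))).
      - intros x Hx. exact (holomorphic_rdiff _ _ _ HF Hx).
      - intros t Ht. split. apply Dsub, gD, Ht. split. apply Dg. apply Cdg.
      - intros s Hs. assert (Hgs := gD s ltac:(lra)).
        destruct (Hpsi _ Hgs) as [W1 [Z1 _]].
        destruct (HW (psi (g s)) W1) as [I1 [I2 [I3 [C1 [_ [_ [R1 _]]]]]]].
        { rewrite Z1. apply Dsub, Hgs. }
        exists I1. split. lra.
        apply (C1 (fun t => g (s * t)) (fun t => RtoC s * dg (s * t)%R)%C).
        split; [|split].
        + cbv beta. rewrite Rmult_0_r. exact g0.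
        + cbv beta. rewrite Rmult_1_r. symmetry. exact Z1.
        + intros t Ht. split; [|split].
          * apply Dsub, gD. nra.
          * assert (Dl : is_derive (fun t => s * t) t s).
            { auto_derive; auto. ring. }
            assert (Q := is_derive_comp (K := R_AbsRing) (V := C_R_NormedModule) g (fun t => s * t) t _ _ (Dg (s * t)) Dl).
            replace (RtoC s * dg (s * t)%R)%C with (scal (V := C_R_NormedModule) s (dg (s * t)%R)). exact Q.
            apply injective_projections; unfold scal; simpl; unfold scal; simpl; unfold mult; simpl; ring.
          * apply (path_cont_mult (fun _ => RtoC s) (fun t => dg (s * t)%R)).
            apply (@continuous_const R_UniformSpace C_R_NormedModule).
            apply (continuous_comp (fun t => s * t) dg). 2: apply Cdg.
            apply (continuous_mult (K := R_AbsRing)). apply continuous_const. apply continuous_id. }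
    destruct (Hpsi w Hw) as [_ [_ Dpsi]]. fold b in Dpsi.
    assert (Dpsi' : rdiff psi (g 1) (- (w * w * Cconj b)) b) by (rewrite g1; exact Dpsi).
    assert (Q := is_derive_Re _ _ _ (rdiff_along _ _ _ _ _ _ (Dg 1) Dpsi')). rewrite dg1 in Q.
    assert (Q2 : is_derive (fun s => Re (psi (g s)) - Re p) 1 (Re (- (w * w * Cconj b) * d + b * Cconj d)%C - 0)).
    { apply (is_derive_minus (V := R_NormedModule)). exact Q. apply (is_derive_const (V := R_NormedModule)). }
    assert (U1 := is_derive_unique _ _ _ DX'). rewrite (is_derive_unique _ _ _ Q2) in U1.
    replace (Re (E * d)%C) with (Re ((1 - w ^ 2) * C_derive F w * d)%C - (Re (- (w * w * Cconj b) * d + b * Cconj d)%C - 0)).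
    rewrite U1. ring.
    unfold E, Re; simpl. ring. }
  assert (N1 : (1 - w ^ 2)%C <> 0).
  { destruct (Hpsi w Hw) as [_ [Z1 _]]. rewrite <- Z1 at 1. apply zeta_sqr_neq1. }
  apply Cmult_eq_reg_r with (1 - w ^ 2)%C; auto.
  replace (C_derive F w * (1 - w ^ 2))%C with (E + Cconj b * (1 - w ^ 2))%C by (unfold E; ring).
  rewrite E0. ring.
Qed.

(** * Local representation by rho and sigma *)

Theorem mainTheorem2 :
  forall (U : C -> Prop) (phi : C -> R) (p : C),
  open U ->
  smooth U phi ->
  minimal_surface_eq U phi ->
  U p ->
  (dz (dz (ofR phi)) p * dzbar (dzbar (ofR phi)) p
   - (dzbar (dz (ofR phi)) p) ^ 2)%C <> RtoC 0 ->
  (exists (N V : C -> Prop) (psi : C -> C),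
     N p /\ (forall z, N z -> U z) /\
     complex_coordinate phi N (zeta phi) V psi) /\
  forall (W : C -> Prop) (r : R) (F : C -> C),
  let zeta0 := zeta phi p in
  open W -> W p -> (forall z, W z -> U z) ->
  0 < r ->
  holomorphic_on (Cdisc zeta0 r) F ->
  (forall z, W z -> Cdisc zeta0 r (zeta phi z) -> weierstrass_at phi p r F z) ->
  C_derive F zeta0 <> RtoC 0 ->
  let G := fun eta : C => Cconj (F (Cconj eta)) in
  let rho := fun z : C => F (zeta phi z) in
  let sigma := fun z : C => Cconj (rho z) in
  let rho0 := F zeta0 in
  let sigma0 := Cconj rho0 in
  exists (N : C -> Prop) (r' : R) (psi Finv Ginv : C -> C) (c1 c2 c3 : R),
    let Drho := Cdisc rho0 r' in
    let Dsigma := Cdisc sigma0 r' in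
    (* phi as a function of rho, phi_rho as a function of rho, and phi_sigma as
       a function of sigma *)
    let Phi := fun w : C => phi (psi w) in
    let phi_rho := dz (ofR Phi) in
    let phi_sigma := fun s : C => dzbar (ofR Phi) (Cconj s) in
    N p /\ (forall z, N z -> W z) /\ 0 < r' /\
    complex_coordinate phi N rho Drho psi /\
    local_inverse F zeta0 r Finv r' /\
    local_inverse G (Cconj zeta0) r Ginv r' /\
    (forall z, N z -> sigma z = G (Cconj (zeta phi z))) /\
    (forall z, N z -> exists A B : C,
       is_CInt Drho (fun w => Finv w ^ 2)%C rho0 (rho z) A /\
       is_CInt Dsigma (fun w => Ginv w ^ 2)%C sigma0 (sigma z) B /\
       RtoC (Re z) = (c1 + (rho z + sigma z) / 2 - A / 2 - B / 2)%C /\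
       RtoC (Im z) = (c2 + (sigma z - rho z) / (2 * Ci)
                      - A / (2 * Ci) + B / (2 * Ci))%C) /\
    (forall z, N z -> exists A B : C,
       is_CInt Drho Finv rho0 (rho z) A /\
       is_CInt Dsigma Ginv sigma0 (sigma z) B /\
       RtoC (phi z) = (c3 + A + B)%C) /\
    (forall z, N z ->
       zeta phi z = Finv (rho z) /\ Finv (rho z) = phi_rho (rho z) /\
       Cconj (zeta phi z) = Ginv (sigma z) /\
       Ginv (sigma z) = phi_sigma (sigma z)) /\
    (forall z, N z -> exists A B : C,
       is_CInt Drho (fun w => phi_rho w ^ 2)%C rho0 (rho z) A /\
       is_CInt Dsigma (fun w => phi_sigma w ^ 2)%C sigma0 (sigma z) B /\
       RtoC (Re z) = (c1 + (rho z + sigma z) / 2 - A / 2 - B / 2)%C /\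
       RtoC (Im z) = (c2 + (sigma z - rho z) / (2 * Ci)
                      - A / (2 * Ci) + B / (2 * Ci))%C) /\
    (* a function of rho alone is one that is holomorphic in rho *)
    (exists f g : C -> C,
       holomorphic_on Drho f /\ holomorphic_on Dsigma g /\
       forall z, N z -> RtoC (phi z) = (f (rho z) + g (sigma z))%C).
Proof.
  intros U phi p HU Hf HM Hp Hess.
  assert (Hz := zeta_smooth phi U HU Hf).
  assert (Jz : Jac (zeta phi) p <> 0).
  { intros E. apply Hess. apply (zeta_derivatives U phi p HU Hf HM Hp). exact E. }
  destruct (surface_coordinate U phi (zeta phi) p HU Hf Hp Hz
    (fun z Hzz => proj1 (zeta_derivatives U phi z HU Hf HM Hzz)) Jz)
    as [N0 [eta0 [psi0 [He0 [Np0 [N0U [CC0 [Spsi0 Q0]]]]]]]].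
  cbv zeta in Q0. split.
  { exists N0, (Cdisc (zeta phi p) eta0), psi0. auto. }
  intros W r F zeta0 HW Wp WU Hr HF HWei HF0 G rho sigma rho0 sigma0.
  set (V0 := Cdisc (zeta phi p) eta0) in *. fold zeta0 in V0.
  destruct CC0 as [N0O [V0O [CA [CB _]]]].
  assert (V0p : V0 zeta0) by (apply Cdisc_center; exact He0).
  assert (psip : psi0 zeta0 = p) by (apply (CA p Np0)).
  assert (Cpsi0 : forall w, V0 w -> ccont psi0 w) by (intros w Hw; exact (CkC_ccont 0 V0 psi0 w (Spsi0 0%nat) Hw)).
  (* [B] is a disc on which the inverse of [zeta] is defined with values in [W]. *)
  assert (Hd : near zeta0 (fun w => V0 w /\ W (psi0 w))).
  { apply near_and. exact (open_near _ _ V0O V0p). apply (ccont_near psi0); auto.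
    rewrite psip. exact (open_near _ _ HW Wp). }
  apply near_Cmod in Hd. destruct Hd as [d0 [Hd0 Hd]].
  set (delta := Rmin d0 r). assert (Hdelta : 0 < delta) by (apply Rmin_pos; auto).
  set (B := Cdisc zeta0 delta).
  assert (BV : forall w, B w -> V0 w /\ W (psi0 w)).
  { intros w Hw. apply Hd. eapply Rlt_le_trans. exact Hw. apply Rmin_l. }
  assert (Br : forall w, B w -> Cdisc zeta0 r w).
  { intros w Hw. eapply Rlt_le_trans. exact Hw. apply Rmin_r. }
  assert (HF' : forall w, B w -> C_derive F w = Cconj (dzbar psi0 w)).
  { apply (weierstrass_density phi p W r F psi0 delta); auto. apply Rmin_r.
    intros w Hw. destruct (BV w Hw) as [V W']. split; auto. split. apply CB; exact V.
    destruct (Q0 w V) as [_ [_ [D _]]]. rewrite (proj2 (CB w V)) in D. exact D. }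
  assert (DF : forall w, B w -> rdiff F w (C_derive F w) 0).
  { intros w Hw. apply (holomorphic_rdiff (Cdisc zeta0 r)); auto. }
  assert (BO : open B) by apply Cdisc_open.
  assert (SF' : smoothC B (C_derive F)).
  { intros n. apply (CkC_ext n B (fun w => Cconj (dzbar psi0 w))); auto.
    intros w Hw. symmetry. auto. apply CkC_conj. apply (CkC_sub n V0). apply BV.
    apply (smoothC_dz V0 psi0 V0O Spsi0). }
  assert (SF : smoothC B F).
  { intros [|n]. intros w Hw. exact (rdiff_ccont _ _ _ _ (DF w Hw)).
    exists (C_derive F), (fun _ => RtoC 0). split; [exact DF|]. split. apply SF'. apply CkC_const. }
  set (N1 := fun z => U z /\ W z /\ N0 z /\ B (zeta phi z)).
  assert (N1p : N1 p) by (split; [|split; [|split]]; auto; apply Cdisc_center; auto).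
  assert (N1U : forall z, N1 z -> U z) by (intros z Hz1; apply Hz1).
  assert (N1O : open N1).
  { intros z [H1 [H2 [H3 H4]]]. apply (near_and z). exact (open_near _ _ HU H1).
    apply (near_and z). exact (open_near _ _ HW H2). apply (near_and z). exact (open_near _ _ N0O H3).
    apply ccont_near. exact (CkC_ccont 0 U _ z (Hz 0%nat) H1). exact (open_near _ _ BO H4). }
  assert (Srho : smoothC N1 rho).
  { intros n. apply (CkC_comp n N1 B (zeta phi) F). intros z Hz1; apply Hz1.
    apply (CkC_sub n U); auto. apply SF. }
  assert (Drho : forall z, N1 z -> dz rho z = (C_derive F (zeta phi z) * dz (zeta phi) z)%C /\
     dzbar rho z = (C_derive F (zeta phi z) * dzbar (zeta phi) z)%C).
  { intros z Hz1. destruct (smoothC_dz U _ HU Hz) as [D _].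
    assert (R := rdiff_comp _ F z _ _ _ _ (D z (N1U z Hz1)) (DF _ (proj2 (proj2 (proj2 Hz1))))).
    destruct (rdiff_dz _ _ _ _ R) as [E1 E2].
    change (fun w => F (zeta phi w)) with rho in E1, E2. rewrite E1, E2. split; ring. }
  assert (Jrho : forall z, N1 z -> Jac rho z =
     (C_derive F (zeta phi z) * Cconj (C_derive F (zeta phi z)) * Jac (zeta phi) z)%C).
  { intros z Hz1. destruct (Drho z Hz1) as [E1 E2]. unfold Jac. rewrite E1, E2, !Cmult_conj. ring. }
  assert (conj0 : forall c : C, c <> 0 -> Cconj c <> 0).
  { intros c Hc E. apply Hc. rewrite <- (Cconj_conj c), E. apply Cconj_RtoC. }
  assert (fN1 : smooth N1 phi) by (intros n; apply (Ck_sub n U); auto).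
  destruct (surface_coordinate N1 phi rho p N1O fN1 N1p Srho) as [N [r' [psi [Hr' [Np [NN1 [CC [Spsi Q]]]]]]]].
  { intros z Hz1. destruct (Drho z Hz1) as [-> ->].
    rewrite (proj1 (zeta_derivatives U phi z HU Hf HM (N1U z Hz1))). ring. }
  { rewrite Jrho by exact N1p. apply Cmult_neq_0; auto. apply Cmult_neq_0; auto. }
  cbv zeta in Q. change (rho p) with rho0 in *.
  set (V := Cdisc rho0 r') in *.
  assert (CC' := CC). destruct CC' as [NO [VO [CA' [CB' _]]]].
  assert (V0r : V rho0) by (apply Cdisc_center; exact Hr').
  assert (psir : psi rho0 = p) by (apply (CA' p Np)).
  set (Finv := fun w => zeta phi (psi w)).
  assert (Npsi : forall w, V w -> N1 (psi w)) by (intros w Hw; apply NN1, CB', Hw).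
  (* Since [F'] is the conjugate of the derivative of [psi0] in [Cconj zeta], passing from
     [zeta] to [rho] normalizes that derivative to 1. *)
  assert (Dpsi : forall w, V w -> rdiff psi w (- (Finv w * Finv w)) 1 /\
     dz (ofR (fun s => phi (psi s))) w = Finv w).
  { intros w Hw. destruct (Q w Hw) as [J0 [E1 [D E2]]].
    assert (Nw := Npsi w Hw). assert (J1 := Jrho _ Nw).
    destruct (Drho _ Nw) as [_ E3]. destruct Nw as [_ [_ [Nw0 Bw]]].
    destruct (CA _ Nw0) as [Vz Ez]. destruct (Q0 _ Vz) as [J2 [E4 _]].
    assert (E5 := HF' _ Bw). rewrite Ez in E4, J2.
    assert (Fn0 : C_derive F (zeta phi (psi w)) <> 0).
    { intros E. apply J0. rewrite J1, E. ring. }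
    assert (E6 : dzbar psi w = 1).
    { rewrite E1, E3, J1.
      transitivity (dzbar psi0 (zeta phi (psi w)) / Cconj (C_derive F (zeta phi (psi w))))%C.
      rewrite E4. field. auto. rewrite E5 at 1. rewrite Cconj_conj.
      assert (dzbar psi0 (zeta phi (psi w)) <> 0).
      { intros E. apply Fn0. rewrite E5, E. apply Cconj_RtoC. }
      field. auto. }
    rewrite E6 in D, E2. rewrite Cconj_RtoC in D, E2. split.
    - eapply rdiff_eq. exact D. unfold Finv. ring. reflexivity.
    - rewrite E2. unfold Finv. ring. }
  assert (SFinv : smoothC V Finv).
  { intros n. apply (CkC_comp n V U psi (zeta phi)). intros w Hw. apply N1U, Npsi, Hw. apply Spsi. apply Hz. }
  assert (DFinv : forall w, V w -> rdiff Finv w (dz Finv w) 0).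
  { intros w Hw. destruct (smoothC_dz V Finv VO SFinv) as [D _]. eapply rdiff_eq. exact (D w Hw). reflexivity.
    destruct (smoothC_dz U _ HU Hz) as [Dz _]. assert (Uw := N1U _ (Npsi w Hw)).
    assert (R := rdiff_comp psi (zeta phi) w _ _ _ _ (proj1 (Dpsi w Hw)) (Dz _ Uw)).
    assert (E := proj2 (rdiff_dz _ _ _ _ R)). change (fun w => zeta phi (psi w)) with Finv in E. rewrite E.
    rewrite (proj1 (zeta_derivatives U phi _ HU Hf HM Uw)).
    rewrite Copp_conj, Cmult_conj. unfold Finv. ring. }
  assert (LI : local_inverse F zeta0 r Finv r').
  { split; [|split; [|split]].
    - intros w Hw. eexists. apply rdiff_is_derive. exact (DFinv w Hw).
    - unfold Finv. change (F zeta0) with rho0. rewrite psir. reflexivity.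
    - intros w Hw. split. apply Br, (Npsi w Hw). apply (CB' w Hw).
    - assert (Nn : near zeta0 (fun w => V0 w /\ N (psi0 w))).
      { apply near_and. exact (open_near _ _ V0O V0p). apply (ccont_near psi0); auto.
        rewrite psip. exact (open_near _ _ NO Np). }
      revert Nn. apply near_imp. intros w [H1 H2]. unfold Finv.
      destruct (CB w H1) as [_ E]. rewrite <- E at 1.
      change (zeta phi (psi (rho (psi0 w))) = w). rewrite (proj2 (CA' _ H2)). exact E. }
  set (Ginv := fun s => Cconj (Finv (Cconj s))).
  (* A primitive of [Finv ^ 2] is explicit, because [psi] is [Cconj w] minus such a primitive. *)
  set (K := fun w => (Cconj w + -1 * psi w)%C).
  assert (DK : forall w, V w -> rdiff K w (Finv w ^ 2)%C 0).
  { intros w Hw. eapply rdiff_eq. apply rdiff_plus. apply rdiff_Cconj. apply rdiff_scal. apply (Dpsi w Hw).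
    simpl. ring. ring. }
  destruct (holomorphic_primitive rho0 r' Finv (dz Finv) DFinv) as [J DJ].
  { intros w Hw. apply (CkC_ccont 0 V); auto. apply (smoothC_dz V Finv VO SFinv). }
  fold V in DJ.
  set (Vs := Cdisc sigma0 r').
  assert (VsV : forall s, Vs s -> V (Cconj s)) by (intros s; apply Cdisc_conj).
  assert (Cont : forall f, smoothC V f -> forall w, V w -> ccont f w) by (intros f Hs w Hw; exact (CkC_ccont 0 V f w (Hs 0%nat) Hw)).
  assert (CI : forall f H a b, smoothC V f -> (forall w, V w -> rdiff H w (f w) 0) ->
     is_CInt V f a b (H b - H a)%C /\
     is_CInt Vs (fun s => Cconj (f (Cconj s))) (Cconj a) (Cconj b) (Cconj (H b - H a))).
  { intros f H a b Sf DH. split. apply primitive_CInt; auto.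
    assert (Q2 := primitive_CInt Vs (fun s => Cconj (f (Cconj s))) (fun s => Cconj (H (Cconj s))) (Cconj a) (Cconj b)).
    cbv beta in Q2. rewrite !Cconj_conj in Q2. rewrite Cminus_conj. apply Q2.
    - intros s Hs. apply rdiff_conj_conj. apply DH. auto.
    - intros s Hs. apply (ccont_comp (fun s => f (Cconj s))). apply (ccont_comp Cconj). apply ccont_Cconj. apply Cont; auto.
      apply ccont_Cconj. }
  assert (SF2 : smoothC V (fun w => Finv w ^ 2)%C).
  { intros n. apply (CkC_ext n V (fun w => Finv w * Finv w)%C); auto. intros w _. simpl. ring. apply CkC_mult; apply SFinv. }
  (* The derivatives of [phi - 2 Re J] in [rho] vanish. *)
  assert (HPhi : forall z, N z -> RtoC (phi z) = (phi p + (J (rho z) - J rho0) + Cconj (J (rho z) - J rho0))%C).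
  { intros z Hzn. destruct (CA' z Hzn) as [Vz Ez].
    set (H := fun w => (ofR (fun s => phi (psi s)) w + -1 * (J w + Cconj (J w)))%C).
    assert (DH : forall w, V w -> rdiff H w 0 0).
    { intros w Hw.
      assert (Hp1 : smoothC V (ofR (fun s => phi (psi s)))).
      { intros n. apply (CkC_comp n V U psi (ofR phi)). intros y Hy. apply N1U, Npsi, Hy. apply Spsi. apply Ck_CkC; auto. }
      destruct (smoothC_dz V _ VO Hp1) as [Dp _].
      eapply rdiff_eq. apply rdiff_plus. exact (Dp w Hw). apply rdiff_scal. apply rdiff_plus. exact (DJ w Hw).
      apply rdiff_conj. exact (DJ w Hw).
      rewrite (proj2 (Dpsi w Hw)), Cconj_RtoC. ring.
      rewrite dzbar_ofR, (proj2 (Dpsi w Hw)). ring. }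
    assert (E : H (rho z) = H rho0).
    { apply Cmod_small_eq. intros eps He. eapply Rle_trans.
      apply (mean_value_ineq H (rho z) rho0 0 (fun _ => 0) (fun _ => 0)).
      - intros t Ht w. split. apply DH. apply Cdisc_segment; auto. rewrite Cmod_0. lra.
      - lra. }
    unfold H, ofR in E. rewrite Ez, psir in E.
    replace (RtoC (phi z)) with ((phi z + -1 * (J (rho z) + Cconj (J (rho z)))) + (J (rho z) + Cconj (J (rho z))))%C by ring.
    rewrite E, Cminus_conj. ring. }
  assert (HXY : forall z, N z -> let A := (K (rho z) - K rho0)%C in
    RtoC (Re z) = (RtoC (Re p - Re rho0) + (rho z + sigma z) / 2 - A / 2 - Cconj A / 2)%C /\
    RtoC (Im z) = (RtoC (Im p + Im rho0) + (sigma z - rho z) / (2 * Ci) - A / (2 * Ci) + Cconj A / (2 * Ci))%C).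
  { intros z Hzn A. unfold A, K, sigma. rewrite psir, (proj2 (CA' z Hzn)).
    split; apply injective_projections; unfold Re, Im; simpl; field. }
  exists N, r', psi, Finv, Ginv, (Re p - Re rho0), (Im p + Im rho0), (phi p).
  intros Drho' Dsigma Phi phi_rho phi_sigma.
  assert (Ephi : forall w, V w -> phi_rho w = Finv w) by (intros w Hw; apply (Dpsi w Hw)).
  assert (Esig : forall s, Vs s -> phi_sigma s = Ginv s).
  { intros s Hs. unfold phi_sigma, Ginv. rewrite dzbar_ofR. f_equal. apply Ephi. auto. }
  assert (CIx : forall D f g a b I, (forall w, D w -> f w = g w) -> is_CInt D f a b I -> is_CInt D g a b I).
  { intros D f g a b I E H ga dga Hg. apply (is_RInt_ext (V := C_R_NormedModule) (fun t => f (ga t) * dga t)%C).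
    - intros t. rewrite Rmin_left, Rmax_right by lra. intros Ht. rewrite E. reflexivity. apply Hg. lra.
    - exact (H ga dga Hg). }
  split; [exact Np|]. split; [intros z Hzn; apply (NN1 z Hzn)|]. split; [exact Hr'|]. split; [exact CC|].
  split; [exact LI|]. split; [exact (local_inverse_conj F zeta0 r Finv r' LI)|].
  split; [|split; [|split; [|split; [|split]]]].
  - intros z Hzn. unfold sigma, rho, G. rewrite Cconj_conj. reflexivity.
  - intros z Hzn. destruct (CI _ K rho0 (rho z) SF2 DK) as [CA1 CA2].
    exists (K (rho z) - K rho0)%C, (Cconj (K (rho z) - K rho0)). split; [exact CA1|]. split; [|exact (HXY z Hzn)].
    apply (CIx _ _ _ _ _ _ (fun s _ => Cpow_conj (Finv (Cconj s)) 2) CA2).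
  - intros z Hzn. destruct (CI _ J rho0 (rho z) SFinv DJ) as [CA1 CA2].
    exists (J (rho z) - J rho0)%C, (Cconj (J (rho z) - J rho0)). split; [exact CA1|]. split; [exact CA2|].
    exact (HPhi z Hzn).
  - intros z Hzn. destruct (CA' z Hzn) as [Vz Ez].
    assert (Vsz : Vs (sigma z)). { apply (Cdisc_conj sigma0 r' (rho z)). unfold sigma0. rewrite Cconj_conj. exact Vz. }
    assert (E1 : zeta phi z = Finv (rho z)) by (unfold Finv; rewrite Ez; reflexivity).
    split; [exact E1|]. split; [symmetry; auto|]. split; [|symmetry; auto].
    unfold Ginv, sigma. rewrite Cconj_conj, <- E1. reflexivity.
  - intros z Hzn. destruct (CI _ K rho0 (rho z) SF2 DK) as [CA1 CA2].
    exists (K (rho z) - K rho0)%C, (Cconj (K (rho z) - K rho0)). split; [|split; [|exact (HXY z Hzn)]].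
    + apply (CIx _ _ _ _ _ _ (fun w Hw => f_equal (fun c => (c ^ 2)%C) (eq_sym (Ephi w Hw))) CA1).
    + refine (CIx _ _ _ _ _ _ _ CA2). intros s Hs. rewrite (Esig s Hs). apply Cpow_conj.
  - exists (fun w => phi p + (J w + - J rho0))%C, (fun s => Cconj (J (Cconj s)) + - Cconj (J rho0))%C.
    split; [|split].
    + intros w Hw. eexists. apply rdiff_is_derive. eapply rdiff_eq. apply rdiff_plus. apply rdiff_const.
      apply rdiff_plus. exact (DJ w Hw). apply rdiff_const. reflexivity. ring.
    + intros s Hs. eexists. apply rdiff_is_derive. eapply rdiff_eq.
      apply rdiff_plus. apply rdiff_conj_conj. apply DJ. auto. apply rdiff_const. reflexivity. ring.
    + intros z Hzn. rewrite (HPhi z Hzn). unfold sigma. rewrite Cconj_conj, Cminus_conj. ring.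
Qed.
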